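(* Let $K$ be an algebraically closed field of characteristic $0$ and let $A_1$ be the first Weyl algebra over $K$. Assume $z\in A_1$ is nilpotent or semisimple. Then there exists a unique pair $(k,n)\in(\mathbb{Z}_{\ge 0})^2\setminus\{(0,0)\}$ with $k\ge n\ge 0$ such that $\phi(z)\in A_1(k,n)$ for some $\phi\in\mathrm{Aut}(A_1)$. If $z$ is strictly semisimple, then $(k,n)=(1,1)$. If $z$ is nilpotent or weak semisimple, then $k>n$; and if in addition $z\simeq z_1$, $z\simeq z_2$ with $z_1,z_2\in A_1(k,n)$, then $z_2=\phi(z_1)$ for some $\phi\in G_0'$.
   Context: $A_1$ is the associative $K$-algebra generated by $\mathbf{p},\mathbf{q}$ with relation $[\mathbf{q},\mathbf{p}]=1$; the elements $\mathbf{p}^i\mathbf{q}^j$ ($i,j\ge0$) form a $K$-basis, and the center of $A_1$ is $K$. $\mathrm{Aut}(A_1)$ is the group of $K$-algebra automorphisms of $A_1$. For $z,w\in A_1$ write $z\simeq w$ if $w=\phi(z)$ for some $\phi\in\mathrm{Aut}(A_1)$. For $k,n\in\mathbb{Z}_{\ge0}$, $A_1(k,n)$ is the set of $z=\sum a_{ij}\mathbf{p}^i\mathbf{q}^j\in A_1$ with $a_{kn}\ne0$ and $a_{ij}=0$ whenever $i>k$ or $j>n$. $G_0'$ is the subgroup of $\mathrm{Aut}(A_1)$ of all $\phi$ with $\phi(\mathbf{p})=a_1\mathbf{p}+c_1$, $\phi(\mathbf{q})=a_2\mathbf{q}+c_2$, where $a_1,a_2,c_1,c_2\in K$ and $a_1a_2=1$.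 Dixmier partition: for $z\in A_1\setminus K$ let $\mathrm{ad}_z(w)=[z,w]$, $C(z)=\ker \mathrm{ad}_z$, $N(z)=\bigcup_{m>0}\ker(\mathrm{ad}_z)^m$, and $D(z)=\bigoplus_{\lambda}\ker(\mathrm{ad}_z-\lambda)$, the sum being over the eigenvalues $\lambda\in K$ of $\mathrm{ad}_z$. The element $z$ is strictly nilpotent if $N(z)=A_1$; weak nilpotent if $N(z)\ne C(z)$ and $N(z)\neq A_1$; strictly semisimple if $D(z)=A_1$; weak semisimple if $D(z)\ne C(z)$ and $D(z)\ne A_1$; generic if $D(z)=N(z)=C(z)$. These five classes are disjoint and exhaust $A_1\setminus K$. Nilpotent means strictly or weak nilpotent; semisimple means strictly or weak semisimple. *)

(* Defs.v *)
From HB Require Import structures.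
From mathcomp Require Import all_boot all_order all_algebra.
From mathcomp Require Import classical_sets.

Set Implicit Arguments.
Unset Strict Implicit.
Unset Printing Implicit Defensive.

Import GRing.Theory.

Local Open Scope classical_set_scope.
Local Open Scope ring_scope.

(* The presentation K<p, q | q p - p q = 1>, as a universal property; the
   uniqueness of f says that p and q generate A. *)
Definition weyl_algebra (K : fieldType) (A : algType K) (p q : A) : Prop :=
  q * p - p * q = 1 /\
  forall (B : algType K) (x y : B), y * x - x * y = 1 ->
    exists f : {lrmorphism A -> B},
      [/\ f p = x, f q = y &
          forall g : {lrmorphism A -> B}, g p = x -> g q = y -> g =1 f].

Definition weyl_box (K : fieldType) (A : algType K) (p q : A) (k n : nat) :
    set A :=
  [set z | exists2 a : nat -> nat -> K, a k n != 0 &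
     z = \sum_(i < k.+1) \sum_(j < n.+1) a i j *: (p ^+ i * q ^+ j)].

Definition aut_equiv (K : fieldType) (A : algType K) (z w : A) : Prop :=
  exists2 phi : {lrmorphism A -> A}, bijective phi & w = phi z.

Definition G0' (K : fieldType) (A : algType K) (p q : A) :
    set {lrmorphism A -> A} :=
  [set phi | bijective phi /\ exists a1 a2 c1 c2 : K,
     [/\ a1 * a2 = 1, phi p = a1 *: p + c1%:A & phi q = a2 *: q + c2%:A]].

Section Dixmier.
Variables (K : fieldType) (A : algType K).
Implicit Types (z w : A) (l : K).

Definition ad z w : A := z * w - w * z.

Definition ad_ker z : set A := [set w | ad z w = 0].

Definition ad_nil z : set A :=
  \bigcup_(m in [set m | (0 < m)%N]) [set w | iter m (ad z) w = 0].

Definition ad_eigenspace z l : set A := [set w | ad z w - l *: w = 0].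

Definition ad_eigenvalue z : set K :=
  [set l | exists2 w, w != 0 & ad_eigenspace z l w].

(* The sum of the eigenspaces; it is direct since eigenvectors for distinct
   eigenvalues are linearly independent. *)
Definition ad_diag z : set A :=
  [set w | exists (m : nat) (l : 'I_m -> K) (v : 'I_m -> A),
     (forall i, ad_eigenvalue z (l i) /\ ad_eigenspace z (l i) (v i)) /\
     w = \sum_i v i].

Definition nonscalar z : Prop := ~ range (in_alg A) z.

Definition strictly_nilpotent z := nonscalar z /\ ad_nil z = setT.

Definition weak_nilpotent z :=
  [/\ nonscalar z, ad_nil z <> ad_ker z & ad_nil z <> setT].

Definition strictly_semisimple z := nonscalar z /\ ad_diag z = setT.

Definition weak_semisimple z :=
  [/\ nonscalar z, ad_diag z <> ad_ker z & ad_diag z <> setT].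

Definition is_nilpotent z := strictly_nilpotent z \/ weak_nilpotent z.

Definition is_semisimple z := strictly_semisimple z \/ weak_semisimple z.

End Dixmier.

Definition box_type (K : fieldType) (A : algType K) (p q z : A)
    (kn : nat * nat) : Prop :=
  [/\ kn <> (0, 0)%N, (kn.2 <= kn.1)%N &
      exists2 phi : {lrmorphism A -> A}, bijective phi &
        weyl_box p q kn.1 kn.2 (phi z)].

(* Main.v *)
(* In both cases some w satisfies [z, w] = l w <> 0 or [z, w] <> 0 = [z, [z, w]].
   For positive weights (r, s) of p and q, ad z is then nilpotent on the leading
   forms as soon as wt z > r + s, so that some form g has H = {f, g} <> 0 and
   {f, H} = 0, f being the leading form of z. Setting p = 1 and comparing orders
   at the roots of f and degrees, f turns out to be c (q - a)^N as soon as r < s,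
   and for r = s = 1 after a linear change of variables. Hence in an element of
   minimal total degree in the orbit the total degree is attained at a single
   monomial (a, b), and an edge of the Newton polygon issuing from (a, b) can be
   removed by q -> q + c p^t, contradicting minimality: z lies in a box.
   Uniqueness and rigidity: if phi maps a box to a box, then for all positive
   weights the leading forms of phi p and phi q divide a monomial, so phi p and
   phi q lie in boxes too; these are (1, 0) or (0, 1), because phi^-1 maps phi p
   to p, which has total degree 1. *)
Require Import Defs.
From HB Require Import structures.
From mathcomp Require Import all_boot all_order all_algebra.
From mathcomp Require Import boolp classical_sets.
From mathcomp Require Import zify_ssreflect.
From Stdlib Require Import Lia.

Set Implicit Arguments.
Unset Strict Implicit.
Unset Printing Implicit Defensive.

Import GRing.Theory.
Local Open Scope ring_scope.

(** The existence of a box uses of w only that the orbit of w under ad z has bounded weight and that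
    the products z^i w^j are independent. Both facts hold for an eigenvector with nonzero eigenvalue
    and for a vector killed by (ad z)^2 but not by ad z, so the two classes share one proof.
    Bracketing with the leading form of z raises weights by wt z - r - s > 0, hence along a bounded
    orbit the brackets of leading forms must eventually vanish. Separation of the classes: for n = k
    > 1 the weight 2k equals (1 + 1) times the degree of the leading form at p = 1, a value that the
    comparison of orders and degrees excludes. The box (1, 1) contains only conjugates of a p q + b,
    for which ad is diagonalisable. If z is strictly semisimple, n = 0 would make ad z lower a
    weight strictly, leaving no nonzero eigenvalue; n > 0 with k + n > 2 would make the weight of
    (ad z)^m p grow without bound, although sums of eigenvectors have bounded orbits. *)

(** * A model of the Weyl algebra: operators on symbols *)

Section SymbolEndomorphisms.
Variable K : fieldType.

Definition symb_linear (f : (nat -> nat -> K) -> nat -> nat -> K) : Prop :=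
  forall c u v,
    f (fun i j => c * u i j + v i j) = fun i j => c * f u i j + f v i j.

(* The symbol sum a_ij p^i q^j is encoded by its coefficients; acting on symbols
   by left multiplication shows that the monomials p^i q^j are independent. *)
Record symb_end := SymbEnd {
  symb_fun :> (nat -> nat -> K) -> nat -> nat -> K;
  symb_funP : symb_linear symb_fun }.

HB.instance Definition _ := gen_eqMixin symb_end.
HB.instance Definition _ := gen_choiceMixin symb_end.

Implicit Types f g h : symb_end.

Lemma symb_end_eq f g : (forall u i j, f u i j = g u i j) -> f = g.
Proof.
case: f g => [f fP] [g gP] /= fg.
have {}fg : f = g by apply: funext => u; apply: funext => i; apply: funext.
by subst g; congr SymbEnd; apply: Prop_irrelevance.
Qed.

Fact symb_zero_subproof : symb_linear (fun _ _ _ => 0).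
Proof. by move=> c u v; do 2!apply: funext => ?; rewrite mulr0 addr0. Qed.
Fact symb_opp_subproof f : symb_linear (fun u i j => - f u i j).
Proof.
by move=> c u v; do 2!apply: funext => ?; rewrite symb_funP mulrN opprD.
Qed.
Fact symb_add_subproof f g : symb_linear (fun u i j => f u i j + g u i j).
Proof.
by move=> c u v; do 2!apply: funext => ?; rewrite !symb_funP mulrDr addrACA.
Qed.
Fact symb_scale_subproof (a : K) f : symb_linear (fun u i j => a * f u i j).
Proof.
by move=> c u v; do 2!apply: funext => ?; rewrite !symb_funP mulrDr mulrCA.
Qed.
Fact symb_one_subproof : symb_linear id.
Proof. by []. Qed.
Fact symb_comp_subproof f g : symb_linear (fun u => f (g u)).
Proof. by move=> c u v; rewrite !symb_funP. Qed.

Definition symb_zero := SymbEnd symb_zero_subproof.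
Definition symb_opp f := SymbEnd (symb_opp_subproof f).
Definition symb_add f g := SymbEnd (symb_add_subproof f g).
Definition symb_scale a f := SymbEnd (symb_scale_subproof a f).
Definition symb_one := SymbEnd symb_one_subproof.
Definition symb_comp f g := SymbEnd (symb_comp_subproof f g).

Fact symb_addA : associative symb_add.
Proof. by move=> f g h; apply: symb_end_eq => u i j /=; rewrite addrA. Qed.
Fact symb_addC : commutative symb_add.
Proof. by move=> f g; apply: symb_end_eq => u i j /=; rewrite addrC. Qed.
Fact symb_add0 : left_id symb_zero symb_add.
Proof. by move=> f; apply: symb_end_eq => u i j /=; rewrite add0r. Qed.
Fact symb_addN : left_inverse symb_zero symb_opp symb_add.
Proof. by move=> f; apply: symb_end_eq => u i j /=; rewrite addNr. Qed.
HB.instance Definition _ :=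
  GRing.isZmodule.Build symb_end symb_addA symb_addC symb_add0 symb_addN.

Fact symb_mulA : associative symb_comp.
Proof. by move=> f g h; apply: symb_end_eq. Qed.
Fact symb_mul1 : left_id symb_one symb_comp.
Proof. by move=> f; apply: symb_end_eq. Qed.
Fact symb_mulr1 : right_id symb_one symb_comp.
Proof. by move=> f; apply: symb_end_eq. Qed.
Fact symb_mulDl : left_distributive symb_comp symb_add.
Proof. by move=> f g h; apply: symb_end_eq. Qed.
Fact symb_mulDr : right_distributive symb_comp symb_add.
Proof.
move=> f g h; apply: symb_end_eq => u i j /=.
have ghE : (fun i j => g u i j + h u i j) = (fun i j => 1 * g u i j + h u i j).
  by do 2!apply: funext => ?; rewrite mul1r.
by rewrite ghE symb_funP mul1r.
Qed.
Fact symb_oner_neq0 : symb_one != 0.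
Proof.
apply/eqP => /(congr1 (fun f : symb_end => f (fun _ _ => 1) 0%N 0%N)) /=.
by apply/eqP; rewrite oner_eq0.
Qed.
HB.instance Definition _ := GRing.Zmodule_isNzRing.Build symb_end
  symb_mulA symb_mul1 symb_mulr1 symb_mulDl symb_mulDr symb_oner_neq0.

Fact symb_scaleA (a b : K) f : symb_scale a (symb_scale b f) = symb_scale (a * b) f.
Proof. by apply: symb_end_eq => u i j /=; rewrite mulrA. Qed.
Fact symb_scale1 : left_id 1 symb_scale.
Proof. by move=> f; apply: symb_end_eq => u i j /=; rewrite mul1r. Qed.
Fact symb_scaleDr : right_distributive symb_scale +%R.
Proof. by move=> a f g; apply: symb_end_eq => u i j /=; rewrite mulrDr. Qed.
Fact symb_scaleDl f : {morph symb_scale^~ f : a b / a + b}.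
Proof. by move=> a b; apply: symb_end_eq => u i j /=; rewrite mulrDl. Qed.
HB.instance Definition _ := GRing.Zmodule_isLmodule.Build K symb_end
  symb_scaleA symb_scale1 symb_scaleDr symb_scaleDl.

Fact symb_scaleAl (a : K) f g : a *: (f * g) = (a *: f) * g.
Proof. exact: symb_end_eq. Qed.
HB.instance Definition _ := GRing.Lmodule_isLalgebra.Build K symb_end symb_scaleAl.
Fact symb_fun0 f : f (fun _ _ => 0) = fun _ _ => 0.
Proof.
pose o (_ _ : nat) : K := 0.
have oE : o = (fun i j => -1 * o i j + o i j).
  by do 2!apply: funext => ?; rewrite mulN1r addNr.
rewrite -/o {1}oE symb_funP; do 2!apply: funext => ?.
by rewrite mulN1r addNr.
Qed.
Fact symb_scaleAr (a : K) f g : a *: (f * g) = f * (a *: g).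
Proof.
apply: symb_end_eq => u i j /=; pose o (_ _ : nat) : K := 0.
have gE : (fun i j => a * g u i j) = (fun i j => a * g u i j + o i j).
  by do 2!apply: funext => ?; rewrite addr0.
by rewrite gE symb_funP symb_fun0 addr0.
Qed.
HB.instance Definition _ := GRing.Lalgebra_isAlgebra.Build K symb_end symb_scaleAr.

(* The formula for q expresses q p^i q^j = p^i q^(j+1) + i p^(i-1) q^j. *)
Fact symb_p_subproof : symb_linear
  (fun u i j => if i is i'.+1 then u i' j else 0).
Proof.
by move=> c u v; apply: funext => -[|i]; apply: funext => j //; rewrite mulr0 addr0.
Qed.
Fact symb_q_subproof : symb_linear
  (fun u i j => (if j is j'.+1 then u i j' else 0) + u i.+1 j *+ i.+1).
Proof.
move=> c u v; apply: funext => i; apply: funext => -[|j].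
  by rewrite !add0r mulrnDl mulrnAr.
by rewrite mulrnDl mulrDr mulrnAr addrACA.
Qed.
Definition symb_p := SymbEnd symb_p_subproof.
Definition symb_q := SymbEnd symb_q_subproof.

Lemma symb_weyl : symb_q * symb_p - symb_p * symb_q = 1.
Proof.
apply: symb_end_eq => u [|i] j /=; first by case: j => [|j]; rewrite add0r subr0 mulr1n.
case: j => [|j] /=; rewrite ?add0r.
  by rewrite [X in X - _]mulrS addrK.
by rewrite opprD addrACA subrr add0r [X in X - _]mulrS addrK.
Qed.

(** On symbols in q alone the derivation term of [symb_q] vanishes, so q^j sends the symbol 1,
    encoded by the delta function, to q^j. *)
Lemma symb_monomE i j k l :
  (symb_p ^+ i * symb_q ^+ j) (fun k l => ((k == 0) && (l == 0))%:R) k l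
    = ((k == i) && (l == j))%:R.
Proof.
have qE : forall j k l, (symb_q ^+ j) (fun k l => ((k == 0) && (l == 0))%:R) k l
    = ((k == 0) && (l == j))%:R.
  elim=> [|j' IH] k' l' //; rewrite exprS /= !IH /= mul0rn addr0.
  by case: l' => [|l']; rewrite ?andbF // IH.
elim: i k => [|i IH] k; first by rewrite expr0 mul1r qE.
by rewrite exprS -mulrA; case: k => [|k] //; exact: IH.
Qed.
End SymbolEndomorphisms.

(** * Normal ordering and the span of the monomials *)

Section SpanningMonomials.
Variables (K : fieldType) (A : algType K) (p q : A).

Inductive pq_span : A -> Prop :=
| PqSpanMonom c i j : pq_span (c *: (p ^+ i * q ^+ j))
| PqSpanAdd x y of pq_span x & pq_span y : pq_span (x + y).

Lemma pq_spanZ c x : pq_span x -> pq_span (c *: x).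
Proof.
elim=> [d i j | {}x y _ IHx _ IHy]; first by rewrite scalerA; left.
by rewrite scalerDr; right.
Qed.

Lemma pq_span_sum (I : Type) (r : seq I) (P : pred I) (F : I -> A) :
  (forall i, P i -> pq_span (F i)) -> pq_span (\sum_(i <- r | P i) F i).
Proof.
move=> FP; apply: (big_ind pq_span) => //; last by move=> *; right.
by rewrite -(scale0r (p ^+ 0 * q ^+ 0)); left.
Qed.

Hypothesis qp1 : q * p - p * q = 1.

Lemma q_pX k : q * p ^+ k = p ^+ k * q + k%:R *: p ^+ k.-1.
Proof.
have qpE : q * p = p * q + 1 by rewrite -qp1 addrC subrK.
elim: k => [|k IH]; first by rewrite expr0 mulr1 mul1r scale0r addr0.
rewrite exprSr mulrA IH mulrDl -mulrA qpE mulrDr mulr1 mulrA -addrA.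
congr (_ + _); case: k {IH} => [|k]; first by rewrite scale0r mul0r addr0 scale1r.
by rewrite -scalerAl -exprSr /= [in RHS]mulrS scalerDl scale1r.
Qed.

(** Leibniz's rule, since commuting q past powers of p differentiates them. For m > k the falling
    factorial is 0, so the truncated exponent [k - m] is harmless. *)
Lemma qX_pX j k : q ^+ j * p ^+ k =
  \sum_(m < j.+1) ('C(j, m) * k ^_ m)%:R *: (p ^+ (k - m) * q ^+ (j - m)).
Proof.
elim: j => [|j IH].
  by rewrite big_ord1 !subn0 bin0 ffactn0 scale1r mul1r mulr1.
have -> : q ^+ j.+1 * p ^+ k =
    \sum_(m < j.+1) ('C(j, m) * k ^_ m)%:R *: (p ^+ (k - m) * q ^+ (j.+1 - m))
  + \sum_(m < j.+1) ('C(j, m) * k ^_ m.+1)%:R *: (p ^+ (k - m.+1) * q ^+ (j - m)).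
  rewrite exprS -mulrA IH mulr_sumr -big_split /=; apply: eq_bigr => m _.
  have mj : (m <= j)%N by rewrite -ltnS.
  rewrite -scalerAr mulrA q_pX mulrDl scalerDr (subSn mj).
  rewrite -(mulrA _ q) -[q * q ^+ _]exprS; congr (_ + _).
  by rewrite -scalerAl scalerA -natrM ffactnSr mulnA subnS.
rewrite (big_ord_recl j.+1) [X in X + _](big_ord_recl j) /= !bin0 -!addrA.
congr (_ + _).
have -> : \sum_(i < j) ('C(j, bump 0 i) * k ^_ bump 0 i)%:R *:
     (p ^+ (k - bump 0 i) * q ^+ (j.+1 - bump 0 i)) =
  \sum_(i < j.+1) ('C(j, i.+1) * k ^_ i.+1)%:R *:
     (p ^+ (k - i.+1) * q ^+ (j - i)) :> A.
  by rewrite big_ord_recr /= bin_small // scale0r addr0.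
rewrite -big_split /=; apply: eq_bigr => i _.
by rewrite /bump /= add1n subSS binS mulnDl natrD scalerDl.
Qed.

Lemma monom_mul i j k l : (p ^+ i * q ^+ j) * (p ^+ k * q ^+ l) =
  \sum_(m < j.+1) ('C(j, m) * k ^_ m)%:R *:
     (p ^+ (i + (k - m)) * q ^+ (j - m + l)).
Proof.
rewrite -mulrA (mulrA (q ^+ j)) qX_pX mulr_suml mulr_sumr.
by apply: eq_bigr => m _; rewrite -scalerAl -scalerAr mulrA mulrA -exprD -mulrA -exprD.
Qed.

Lemma pq_spanM x y : pq_span x -> pq_span y -> pq_span (x * y).
Proof.
elim=> [c i j | {}x x' _ IHx _ IHx'] Sy; last first.
  by rewrite mulrDl; right; [apply: IHx | apply: IHx'].
elim: Sy => [d k l | {}y y' _ IHy _ IHy']; last by rewrite mulrDr; right.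
rewrite -scalerAl -scalerAr; do 2!apply: pq_spanZ.
by rewrite monom_mul; apply: pq_span_sum => m _; left.
Qed.

(** The relation is a parameter because closure under products depends on it, and the subalgebra
    instance is attached to this predicate. *)
Definition pq_span_pred of q * p - p * q = 1 : {pred A} :=
  fun z => `[< pq_span z >].

Fact pq_span_closed : subalg_closed (pq_span_pred qp1).
Proof.
split=> [|c x y|x y].
- apply/asboolP; rewrite -(mulr1 1) -(scale1r (1 * 1)).
  exact: (PqSpanMonom 1 0 0).
- by move=> /asboolP Sx /asboolP Sy; apply/asboolP; right=> //; apply: pq_spanZ.
- by move=> /asboolP Sx /asboolP Sy; apply/asboolP; apply: pq_spanM.
Qed.
HB.instance Definition _ :=
  GRing.isSubalgClosed.Build K A (pq_span_pred qp1) pq_span_closed.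

Definition pq_span_type := {x : A | x \in pq_span_pred qp1}.
HB.instance Definition _ := SubType.on pq_span_type.
HB.instance Definition _ := [Choice of pq_span_type by <:].
HB.instance Definition _ := [SubChoice_isSubAlgebra of pq_span_type by <:].

Definition pq_span_incl (x : pq_span_type) : A := sval x.
Fact pq_span_incl_linear : linear pq_span_incl.
Proof. by []. Qed.
Fact pq_span_incl_mul : monoid_morphism pq_span_incl.
Proof. by []. Qed.
HB.instance Definition _ := GRing.isLinear.Build K pq_span_type A *:%R
  pq_span_incl pq_span_incl_linear.
HB.instance Definition _ := GRing.isMonoidMorphism.Build pq_span_type A
  pq_span_incl pq_span_incl_mul.
End SpanningMonomials.

(** * Consequences of the universal property *)

Section WeylPresentation.
Variables (K : fieldType) (A : algType K) (p q : A).
Hypothesis hA : weyl_algebra p q.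

Lemma weyl_rel : q * p - p * q = 1.
Proof. by case: hA. Qed.

Lemma weyl_hom_ext (B : algType K) (f g : {lrmorphism A -> B}) :
  f p = g p -> f q = g q -> f =1 g.
Proof.
move=> fgp fgq; have [|h [_ _ hu]] := hA.2 B (g p) (g q).
  by rewrite -!rmorphM -rmorphB weyl_rel rmorph1.
by move=> x; rewrite (hu f) // (hu g).
Qed.

(* The span of the monomials is a subalgebra, so the identity of A factors
   through it by the universal property. *)
Lemma weyl_span z : pq_span p q z.
Proof.
pose T := pq_span_type weyl_rel.
have Sp : p \in pq_span_pred weyl_rel.
  by apply/asboolP; rewrite -[X in pq_span _ _ X]mulr1 -[X in pq_span _ _ X]scale1r;
     apply: (PqSpanMonom p q 1 1 0).
have Sq : q \in pq_span_pred weyl_rel.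
  by apply/asboolP; rewrite -[X in pq_span _ _ X]mul1r -[X in pq_span _ _ X]scale1r;
     apply: (PqSpanMonom p q 1 0 1).
have [|f [fp fq _]] := hA.2 T (Sub p Sp) (Sub q Sq).
  apply: val_inj; exact: weyl_rel.
pose g : {lrmorphism A -> A} := @pq_span_incl _ _ _ _ _ \o f.
have -> : z = g z by apply: (weyl_hom_ext (f := idfun)); rewrite /g /= ?fp ?fq.
by have /asboolP := svalP (f z).
Qed.
End WeylPresentation.

(** * Bilinearity of the commutator *)

Section Commutator.
Variables (K : fieldType) (A : algType K).
Implicit Types (x y z : A) (c : K).
Lemma adDl x y z : ad (x + y) z = ad x z + ad y z.
Proof. by rewrite /ad mulrDl mulrDr opprD addrACA. Qed.
Lemma adDr x y z : ad x (y + z) = ad x y + ad x z.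
Proof. by rewrite /ad mulrDl mulrDr opprD addrACA. Qed.
Lemma adZl c x y : ad (c *: x) y = c *: ad x y.
Proof. by rewrite /ad -scalerAl -scalerAr scalerBr. Qed.
Lemma adZr c x y : ad x (c *: y) = c *: ad x y.
Proof. by rewrite /ad -scalerAl -scalerAr scalerBr. Qed.
Lemma ad0l x : ad 0 x = 0.
Proof. by rewrite /ad mul0r mulr0 subrr. Qed.
Lemma ad0r x : ad x 0 = 0.
Proof. by rewrite /ad mul0r mulr0 subrr. Qed.
Lemma ad_algr c x : ad x c%:A = 0.
Proof. by rewrite /ad mulr_algr mulr_algl subrr. Qed.
Lemma ad_algl c x : ad c%:A x = 0.
Proof. by rewrite /ad mulr_algr mulr_algl subrr. Qed.

Lemma ad_affine (a b c d : K) x y :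
  ad (a *: x + c%:A) (b *: y + d%:A) = (a * b) *: ad x y.
Proof. by rewrite adDl ad_algl addr0 adDr ad_algr addr0 adZl adZr scalerA. Qed.
End Commutator.

(** * Coefficients, weight filtrations and leading forms *)

Section Weights.
Variables (K : fieldType) (A : algType K) (p q : A).
Hypothesis hA : weyl_algebra p q.
Local Notation e i j := (p ^+ i * q ^+ j).

Lemma symb_rep_exists : exists f : {lrmorphism A -> symb_end K},
  f p = symb_p K /\ f q = symb_q K.
Proof.
by have [f [fp fq _]] := hA.2 _ _ _ (symb_weyl K); exists f.
Qed.
Definition symb_rep : {lrmorphism A -> symb_end K} := sval (cid symb_rep_exists).

(** The operator of z applied to the symbol 1 is the normally ordered symbol of z. *)
Definition pqcoef z i j := symb_rep z (fun k l => ((k == 0) && (l == 0))%:R) i j.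

Lemma pqcoef_monom i j k l : pqcoef (e i j) k l = ((k == i) && (l == j))%:R.
Proof.
rewrite /pqcoef rmorphM !rmorphXn /symb_rep; case: cid => f /= [-> ->].
exact: symb_monomE.
Qed.
Lemma pqcoefD x y i j : pqcoef (x + y) i j = pqcoef x i j + pqcoef y i j.
Proof. by rewrite /pqcoef rmorphD. Qed.
Lemma pqcoefZ c x i j : pqcoef (c *: x) i j = c * pqcoef x i j.
Proof. by rewrite /pqcoef linearZ. Qed.
Lemma pqcoef0 i j : pqcoef 0 i j = 0.
Proof. by rewrite -(scale0r 0) pqcoefZ mul0r. Qed.
Lemma pqcoefN x i j : pqcoef (- x) i j = - pqcoef x i j.
Proof. by rewrite -scaleN1r pqcoefZ mulN1r. Qed.
Lemma pqcoefB x y i j : pqcoef (x - y) i j = pqcoef x i j - pqcoef y i j.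
Proof. by rewrite pqcoefD pqcoefN. Qed.
Lemma pqcoef_sum (I : Type) (r : seq I) (P : pred I) (F : I -> A) i j :
  pqcoef (\sum_(k <- r | P k) F k) i j = \sum_(k <- r | P k) pqcoef (F k) i j.
Proof.
by apply: (big_morph (fun x => pqcoef x i j)) => [x y|]; rewrite (pqcoefD, pqcoef0).
Qed.

Lemma weyl_expand z : exists n, forall m, (n <= m)%N ->
  z = \sum_(i < m) \sum_(j < m) pqcoef z i j *: e i j.
Proof.
elim: (weyl_span hA z) => [c k l | x y _ [n nP] _ [n' n'P]]; last first.
  exists (maxn n n') => m; rewrite geq_max => /andP[/nP xE /n'P yE].
  rewrite [in LHS]xE [in LHS]yE -big_split; apply: eq_bigr => i _ /=.
  by rewrite -big_split; apply: eq_bigr => j _; rewrite pqcoefD scalerDl.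
exists (maxn k l).+1 => m; rewrite gtn_max => /andP[km lm].
rewrite (bigD1 (Ordinal km)) //= (bigD1 (Ordinal lm)) //=.
rewrite pqcoefZ pqcoef_monom !eqxx mulr1 !big1 ?addr0 // => [i | j].
  rewrite -val_eqE /= => /negPf ik; rewrite big1 // => j _.
  by rewrite pqcoefZ pqcoef_monom ik mulr0 scale0r.
by rewrite -val_eqE /= => /negPf jl; rewrite pqcoefZ pqcoef_monom jl andbF mulr0 scale0r.
Qed.

Lemma pqcoef_inj x y : (forall i j, pqcoef x i j = pqcoef y i j) -> x = y.
Proof.
move=> xy; have [n nP] := weyl_expand x; have [n' n'P] := weyl_expand y.
rewrite (nP _ (leq_maxl n n')) (n'P _ (leq_maxr n n')).
by apply: eq_bigr => i _; apply: eq_bigr => j _; rewrite xy.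
Qed.

Lemma pqcoef_bound z : exists n, forall i j, pqcoef z i j != 0 -> (i < n)%N && (j < n)%N.
Proof.
have [n /(_ n (leqnn n)) zE] := weyl_expand z; exists n => i j.
apply: contraR; rewrite negb_and => ijn; apply/eqP.
rewrite zE pqcoef_sum big1 // => i' _; rewrite pqcoef_sum big1 // => j' _.
rewrite pqcoefZ pqcoef_monom; case: eqP => [ii'|]; last by rewrite mulr0.
case: eqP => [jj'|]; last by rewrite mulr0.
by move: ijn; rewrite ii' jj' !ltn_ord.
Qed.

(** An upper bound rather than a degree, so that 0 needs no convention. The weights may vanish: (1,
    0) and (0, 1) give the degrees in p and in q. *)
Definition wt_le r s v z := forall i j, (v < r * i + s * j)%N -> pqcoef z i j = 0.

Lemma wt_le_ind r s v (P : A -> Prop) :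
  P 0 -> (forall x y, P x -> P y -> P (x + y)) ->
  (forall c i j, (r * i + s * j <= v)%N -> P (c *: e i j)) ->
  forall z, wt_le r s v z -> P z.
Proof.
move=> P0 PD Pe z zv; have [n /(_ n (leqnn n)) ->] := weyl_expand z.
apply: (big_ind P) => // i _; apply: (big_ind P) => // j _.
have [/Pe //|/zv ->] := leqP (r * i + s * j) v; by rewrite scale0r.
Qed.

Section Filtration.
Variables r s : nat.

Lemma wt_le0 v : wt_le r s v 0.
Proof. by move=> i j _; rewrite pqcoef0. Qed.
Lemma wt_leD v x y : wt_le r s v x -> wt_le r s v y -> wt_le r s v (x + y).
Proof. by move=> xv yv i j h; rewrite pqcoefD xv // yv // addr0. Qed.
Lemma wt_leZ v c x : wt_le r s v x -> wt_le r s v (c *: x).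
Proof. by move=> xv i j h; rewrite pqcoefZ xv // mulr0. Qed.
Lemma wt_leN v x : wt_le r s v x -> wt_le r s v (- x).
Proof. by move=> xv i j h; rewrite pqcoefN xv // oppr0. Qed.
Lemma wt_leW v v' x : (v <= v')%N -> wt_le r s v x -> wt_le r s v' x.
Proof. by move=> vv' xv i j h; rewrite xv // (leq_ltn_trans vv'). Qed.
Lemma wt_le_monom v i j : (r * i + s * j <= v)%N -> wt_le r s v (e i j).
Proof.
move=> ijv k l h; rewrite pqcoef_monom; case: eqP => // ki; case: eqP => // lj.
by move: h; rewrite ki lj ltnNge ijv.
Qed.
Lemma wt_le_sum v (I : Type) (t : seq I) (P : pred I) (F : I -> A) :
  (forall i, P i -> wt_le r s v (F i)) -> wt_le r s v (\sum_(i <- t | P i) F i).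
Proof.
by move=> FP; apply: (big_ind (wt_le r s v)) => //; [apply: wt_le0 | apply: wt_leD].
Qed.

Lemma wt_le_exists x : exists v, wt_le r s v x.
Proof.
have [n nP] := pqcoef_bound x; exists (r * n + s * n)%N => i j h; apply/eqP.
apply: contraLR h => /nP /andP[ltin ltjn].
by rewrite -leqNgt leq_add // leq_mul // ltnW.
Qed.

Lemma wt_leM v w x y : wt_le r s v x -> wt_le r s w y -> wt_le r s (v + w) (x * y).
Proof.
move=> xv yw; move: x xv; apply: wt_le_ind => [|x x' IH IH'|c i j ijv].
- by rewrite mul0r; apply: wt_le0.
- by rewrite mulrDl; apply: wt_leD.
move: y yw; apply: wt_le_ind => [|y y' IH IH'|d k l klw].
- by rewrite mulr0; apply: wt_le0.
- by rewrite mulrDr; apply: wt_leD.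
rewrite -scalerAl -scalerAr; do 2!apply: wt_leZ.
rewrite (monom_mul (weyl_rel hA)); apply: wt_le_sum => m _.
by apply/wt_leZ/wt_le_monom; nia.
Qed.

Lemma wt_leX v x n : wt_le r s v x -> wt_le r s (n * v) (x ^+ n).
Proof.
move=> xv; elim: n => [|n IH]; last by rewrite exprS mulSn; apply: wt_leM.
by rewrite expr0 -(mulr1 1); apply: (wt_le_monom (i := 0) (j := 0)); rewrite !muln0.
Qed.
End Filtration.

(* The weight-v component of z, dehomogenised at p = 1; when 0 < r the exponent
   of q determines that of p. *)
Definition wt_lead r s v z : {poly K} :=
  \poly_(j < v.+1) (if (s * j <= v)%N && (r %| v - s * j)%N
                    then pqcoef z ((v - s * j) %/ r) j else 0).

Section LeadingForms.
Variables r s : nat.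
Hypotheses (r_gt0 : (0 < r)%N) (s_gt0 : (0 < s)%N).
Local Notation lead := (wt_lead r s).

Lemma coef_lead z i j : (lead (r * i + s * j) z)`_j = pqcoef z i j.
Proof.
rewrite coef_poly addnK leq_addl dvdn_mulr // mulKn //.
by case: ltnP => //; nia.
Qed.

Lemma lead_neq0 v z j : (lead v z)`_j != 0 -> exists i, (r * i + s * j)%N = v.
Proof.
rewrite coef_poly; case: ifP => _; last by rewrite eqxx.
case: andP => [[sjv /dvdnP[i iE]] _|]; last by rewrite eqxx.
by exists i; rewrite mulnC -iE subnK.
Qed.

Lemma lead_ext v z (f : {poly K}) :
  (forall i j, (r * i + s * j)%N = v -> pqcoef z i j = f`_j) ->
  (forall j, f`_j != 0 -> exists i, (r * i + s * j)%N = v) -> lead v z = f.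
Proof.
move=> zf fv; apply/polyP => j.
have [zj|/lead_neq0[i iv]] := eqVneq (lead v z)`_j 0; last first.
  by rewrite -(zf i) // -iv coef_lead.
have [->//|/fv[i iv]] := eqVneq f`_j 0.
by rewrite -(zf i) // -iv coef_lead.
Qed.

Lemma leadD v x y : lead v (x + y) = lead v x + lead v y.
Proof.
apply/polyP => j; rewrite coefD !coef_poly.
case: ifP => _; last by rewrite addr0.
by case: ifP => _; rewrite ?pqcoefD ?addr0.
Qed.

Lemma leadZ v c x : lead v (c *: x) = c *: lead v x.
Proof.
apply/polyP => j; rewrite coefZ !coef_poly.
case: ifP => _; last by rewrite mulr0.
by case: ifP => _; rewrite ?pqcoefZ ?mulr0.
Qed.

Lemma lead0 v : lead v 0 = 0.
Proof. by rewrite -(scale0r 0) leadZ scale0r. Qed.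

Lemma leadB v x y : lead v (x - y) = lead v x - lead v y.
Proof. by rewrite leadD -scaleN1r leadZ scaleN1r. Qed.

Lemma lead_sum v (I : Type) (t : seq I) (P : pred I) (F : I -> A) :
  lead v (\sum_(k <- t | P k) F k) = \sum_(k <- t | P k) lead v (F k).
Proof.
by apply: (big_morph (lead v)) => [x y|]; rewrite (leadD, lead0).
Qed.

Lemma lead_monom v i j :
  lead v (e i j) = if (r * i + s * j == v)%N then 'X^j else 0.
Proof.
case: (eqVneq (r * i + s * j)%N v) => [ijv|ijv]; apply: lead_ext => [k l klv|k].
- rewrite pqcoef_monom coefXn; congr (_%:R); congr nat_of_bool.
  by apply: andb_idl => /eqP lj; apply/eqP; nia.
- by rewrite coefXn; case: (k =P j) => [->|]; [exists i | rewrite eqxx].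
- rewrite coef0 pqcoef_monom; case: eqP => // ki; case: eqP => // lj.
  by rewrite -klv ki lj eqxx in ijv.
- by rewrite coef0 eqxx.
Qed.

Lemma lead_small v w x : wt_le r s v x -> (v < w)%N -> lead w x = 0.
Proof.
move=> xv vw; apply: lead_ext => [i j ijw | j]; last by rewrite coef0 eqxx.
by rewrite coef0 xv // ijw.
Qed.

Lemma wt_le_lower v x : wt_le r s v.+1 x -> lead v.+1 x = 0 -> wt_le r s v x.
Proof.
move=> xv x0 i j; rewrite leq_eqVlt => /predU1P[vE|]; last exact: xv.
by rewrite -coef_lead -vE x0 coef0.
Qed.

Lemma wt_le0_lead0 x : wt_le r s 0 x -> lead 0 x = 0 -> x = 0.
Proof.
move=> x0 l0; apply: pqcoef_inj => i j; rewrite pqcoef0.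
have [ij0|ij0] := posnP (r * i + s * j); last exact: x0.
by rewrite -coef_lead ij0 l0 coef0.
Qed.

Lemma lead_exists x : x != 0 -> exists2 v, wt_le r s v x & lead v x != 0.
Proof.
move=> x0; have [v] := wt_le_exists r s x; elim: v => [|v IH] xv.
  by exists 0%N => //; apply: contra_neq x0 => /(wt_le0_lead0 xv).
by have [/(wt_le_lower xv)/IH//|lx] := eqVneq (lead v.+1 x) 0; exists v.+1.
Qed.

(** In the product of two monomials only the term m = 0 keeps the full weight; each contraction of a
    q with a p costs r + s > 0. *)
Lemma leadM v w x y : wt_le r s v x -> wt_le r s w y ->
  lead (v + w) (x * y) = lead v x * lead w y.
Proof.
move=> xv yw; move: x xv; apply: wt_le_ind => [|x x' IH IH'|c i j ijv].
- by rewrite mul0r !lead0 mul0r.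
- by rewrite mulrDl !leadD mulrDl IH IH'.
move: y yw; apply: wt_le_ind => [|y y' IH IH'|d k l klw].
- by rewrite mulr0 !lead0 mulr0.
- by rewrite mulrDr !leadD mulrDr IH IH'.
rewrite -scalerAl -scalerAr !leadZ -scalerAl -scalerAr; do 2!congr (_ *: _).
rewrite (monom_mul (weyl_rel hA)) lead_sum big_ord_recl big1 => [|m _].
  rewrite addr0 bin0 ffactn0 scale1r !subn0 !lead_monom.
  have -> : (r * (i + k) + s * (j + l) == v + w)%N =
      (r * i + s * j == v)%N && (r * k + s * l == w)%N by lia.
  by case: eqP; case: eqP => //= _ _; rewrite ?mul0r ?mulr0 // exprD.
rewrite leadZ lead_monom /= /bump add1n.
have [kj|kj] := ltnP k m.+1; first by rewrite ffact_small // muln0 scale0r.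
by case: eqP => [|_]; [have := ltn_ord m; nia | rewrite scaler0].
Qed.

Lemma leadX v x n : wt_le r s v x -> lead (n * v) (x ^+ n) = lead v x ^+ n.
Proof.
move=> xv; elim: n => [|n IH]; last first.
  by rewrite !exprS mulSn leadM ?IH //; apply: wt_leX.
by rewrite !expr0 -(mulr1 1) (lead_monom _ 0 0) !muln0 eqxx.
Qed.

(** Weight at most v - d, written without truncated subtraction: for v < d it forces x = 0. *)
Let low d v x := forall a b, (v < r * a + s * b + d)%N -> pqcoef x a b = 0.

(** The terms with no contraction and with one contraction are subtracted; the others contract at
    least twice and lose 2 (r + s). *)
Lemma monom_mul_low i j k l :
  low (2 * (r + s)) (r * (i + k) + s * (j + l))
    (e i j * e k l - e (i + k) (j + l) - (j * k)%:R *: e (i + k).-1 (j + l).-1).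
Proof.
rewrite (monom_mul (weyl_rel hA)) big_ord_recl bin0 ffactn0 scale1r !subn0.
rewrite [X in X - _ - _]addrC addrK.
case: j => [|j]; first by rewrite big_ord0 mul0n scale0r subr0 => a b _; rewrite pqcoef0.
rewrite big_ord_recl /= bin1 ffactn1.
have -> : (j.+1 * k)%:R *: e (i + (k - 1)) (j.+1 - 1 + l) =
          (j.+1 * k)%:R *: e (i + k).-1 (j + l) :> A.
  case: k => [|k]; first by rewrite muln0 !scale0r.
  by rewrite !subn1 /= addnS.
rewrite addrAC subrr add0r => a b ab; rewrite pqcoef_sum big1 // => m _.
rewrite pqcoefZ pqcoef_monom /= /bump !add1n.
have [kj|kj] := ltnP k m.+2; first by rewrite ffact_small // muln0 mul0r.
case: eqP => [aE|]; last by rewrite mulr0.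
case: eqP => [bE|]; last by rewrite mulr0.
by have := ltn_ord m; nia.
Qed.

Lemma ad_monom_low i j k l :
  low (2 * (r + s)) (r * (i + k) + s * (j + l))
    (ad (e i j) (e k l) - ((j * k)%:R - (l * i)%:R) *: e (i + k).-1 (j + l).-1).
Proof.
move=> a b ab; have /eqP := monom_mul_low ab.
have /eqP := @monom_mul_low k l i j a b ltac:(by rewrite (addnC k) (addnC l)).
rewrite /ad !(pqcoefB, pqcoefZ) mulrBl (addnC k) (addnC l) !subr_eq0.
have cancel X Y C : X - Y - ((X - C) - (Y - C)) = 0 :> K.
  by rewrite [- (Y - C)]opprB addrA subrK subrr.
by move=> /eqP <- /eqP <-; apply: cancel.
Qed.

(** Guards the truncated predecessors: if i + k = 0 or j + l = 0, the bracket coefficient jk - li is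
    0 anyway. *)
Lemma wt_pred i j k l : (j * k = l * i)%N \/
  (r * (i + k).-1 + s * (j + l).-1 + (r + s) = r * i + s * j + (r * k + s * l))%N.
Proof.
case: i => [|i]; case: k => [|k]; first by left; rewrite !muln0.
all: case: j => [|j]; case: l => [|l]; rewrite /= ?addnS /= ?addSn /=;
  by [left | right; nia].
Qed.

Lemma wt_le_comm v w x y : wt_le r s v x -> wt_le r s w y ->
  wt_le r s (v + w - (r + s)) (ad x y).
Proof.
move=> xv yw; move: x xv; apply: wt_le_ind => [|x x' IH IH'|c i j ijv].
- by rewrite ad0l; apply: wt_le0.
- by rewrite adDl; apply: wt_leD.
move: y yw; apply: wt_le_ind => [|y y' IH IH'|d k l klw].
- by rewrite ad0r; apply: wt_le0.
- by rewrite adDr; apply: wt_leD.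
rewrite adZl adZr; do 2!apply: wt_leZ; move=> a b Eab.
have /eqP := @ad_monom_low i j k l a b ltac:(lia).
rewrite pqcoefB subr_eq0 => /eqP ->; rewrite pqcoefZ pqcoef_monom.
case: eqP => [aE|]; last by rewrite mulr0.
case: eqP => [bE|]; last by rewrite mulr0.
suff -> : (j * k = l * i)%N by rewrite subrr mul0r.
by case: (wt_pred i j k l) => //; rewrite -aE -bE; lia.
Qed.

(** The leading form of the commutator is the Poisson bracket f_q g_p - f_p g_q. Euler's identity r
    p f_p + s q f_q = v f eliminates the derivatives in p; the terms with s cancel, and the factor r
    avoids a division. *)
Lemma lead_comm v w x y : (r + s <= v + w)%N -> wt_le r s v x -> wt_le r s w y ->
  r%:R *: lead (v + w - (r + s)) (ad x y) =
  w%:R *: ((lead v x)^`() * lead w y) - v%:R *: (lead v x * (lead w y)^`()).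
Proof.
move=> rsvw xv yw; move: x xv; apply: wt_le_ind => [|x x' IH IH'|c i j ijv].
- by rewrite ad0l !lead0 deriv0 !mul0r !scaler0 subr0.
- rewrite adDl (leadD _ (ad x y)) (leadD _ x) derivD !mulrDl !scalerDr IH IH' opprD !addrA.
  by congr (_ + _); rewrite addrAC.
move: y yw; apply: wt_le_ind => [|y y' IH IH'|d k l klw].
- by rewrite ad0r !lead0 deriv0 !mulr0 !scaler0 subr0.
- rewrite adDr (leadD _ (ad _ y)) (leadD _ y) derivD !mulrDr !scalerDr IH IH' opprD !addrA.
  by congr (_ + _); rewrite addrAC.
rewrite adZl adZr !leadZ !derivZ -!scalerAl -!scalerAr.
have sCA a b (f : {poly K}) : a *: (b *: f) = b *: (a *: f).
  by rewrite !scalerA mulrC.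
rewrite ![_ *: (c *: _)]sCA ![_ *: (d *: _)]sCA -!scalerBr.
congr (_ *: (_ *: _)).
have -> : lead (v + w - (r + s)) (ad (e i j) (e k l)) =
    ((j * k)%:R - (l * i)%:R) *: lead (v + w - (r + s)) (e (i + k).-1 (j + l).-1).
  apply/eqP; rewrite -leadZ -subr_eq0 -leadB; apply/eqP.
  apply: lead_ext => [a b ab | a]; last by rewrite coef0 eqxx.
  by rewrite coef0; apply: ad_monom_low; lia.
rewrite !lead_monom scalerA.
have [ijE|ijN] := eqVneq (r * i + s * j)%N v; last first.
  rewrite deriv0 !mul0r !scaler0 subr0; case: eqP => [E|]; last by rewrite scaler0.
  suff -> : (j * k = l * i)%N by rewrite subrr mulr0 scale0r.
  by case: (wt_pred i j k l) => //; move/eqP: ijN; lia.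
have [klE|klN] := eqVneq (r * k + s * l)%N w; last first.
  rewrite deriv0 !mulr0 !scaler0 subr0; case: eqP => [E|]; last by rewrite scaler0.
  suff -> : (j * k = l * i)%N by rewrite subrr mulr0 scale0r.
  by case: (wt_pred i j k l) => //; move/eqP: klN; lia.
have derX a b : ('X^a)^`() * 'X^b = a%:R *: 'X^((a + b).-1) :> {poly K}.
  by rewrite derivXn -scaler_nat -scalerAl; case: a => [|a]; rewrite ?scale0r // -exprD.
rewrite derX [_ * _^`()]mulrC derX [(l + j)%N]addnC !scalerA -scalerBl.
have -> : r%:R * ((j * k)%:R - (l * i)%:R) = w%:R * j%:R - v%:R * l%:R :> K.
  rewrite mulrBr -!natrM; apply/eqP; rewrite subr_eq addrAC.
  by rewrite eq_sym subr_eq -!natrD -klE -ijE; apply/eqP; congr (_%:R); nia.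
case: eqP => // E; rewrite scaler0 -!natrM.
suff -> : (w * j = v * l)%N by rewrite subrr scale0r.
by case: (wt_pred i j k l) => [jk|]; [nia | lia].
Qed.
End LeadingForms.
End Weights.

(** * Orders and degrees of weighted Wronskians *)

Section Wronskian.
Variable K : fieldType.
Hypothesis charK0 : [pchar K] =i pred0.
Implicit Types F G H : {poly K}.

Lemma natr_inj0 m n : m%:R = n%:R :> K -> m = n.
Proof.
have h0 := (pcharf0P K).1 charK0.
wlog le_mn : m n / (m <= n)%N => [hw E|/eqP].
  by have [/hw->//|/ltnW/hw->//] := leqP m n.
by rewrite eq_sym -subr_eq0 -natrB // h0 subn_eq0 => le_nm; apply/eqP; rewrite eqn_leq le_mn.
Qed.

(* By Euler's identity this is r {f, g} at p = 1, when F and G are the values at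
   p = 1 of (r, s)-homogeneous symbols f and g of weights v and d. *)
Definition wronsk (v d : nat) F G : {poly K} :=
  v%:R *: (F * G^`()) - d%:R *: (F^`() * G).

Lemma wronskZr v d c F G : wronsk v d F (c *: G) = c *: wronsk v d F G.
Proof.
rewrite /wronsk derivZ -!scalerAr scalerBr !scalerA.
by rewrite [v%:R * _]mulrC [d%:R * _]mulrC.
Qed.

Section Local.
Variables (x : K) (v d : nat).
Let u : {poly K} := 'X - x%:P.

Let derivXu n : (u ^+ n)^`() = u ^+ n.-1 *+ n.
Proof. by rewrite deriv_exp /u derivXsubC mul1r. Qed.

Let mulXu m n : u ^+ m * (u ^+ n)^`() = u ^+ (m + n).-1 *+ n.
Proof.
by rewrite derivXu mulrnAr; case: n => [|n]; rewrite ?mulr0n // -exprD addnS.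
Qed.

(** Differentiating the powers of u produces the number vn - dm; if F and G do not vanish at x, it
    decides whether the order at x is exactly m + n - 1 or larger. *)
Lemma wronsk_local m n k F G : (m + n)%N = k.+1 ->
  wronsk v d (u ^+ m * F) (u ^+ n * G) =
  u ^+ k * (((v * n)%:R - (d * m)%:R) *: (F * G) + u * wronsk v d F G).
Proof.
move=> mnk.
have h a b P Q : (a + b)%N = k.+1 -> (u ^+ a * P) * (u ^+ b * Q)^`() =
    u ^+ k * (b%:R *: (P * Q) + u * (P * Q^`())).
  move=> abk; rewrite derivM mulrDr mulrACA mulXu abk /= mulrACA -exprD abk.
  rewrite exprSr -(scaler_nat b) [in RHS](mulrDr (u ^+ k)) -scalerAl -scalerAr.
  by rewrite [in RHS]mulrA.
have sAr (c : nat) P : c%:R *: (u ^+ k * P) = u ^+ k * (c%:R *: P).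
  by rewrite scalerAr.
rewrite /wronsk h // [(u ^+ m * F)^`() * _]mulrC h 1?addnC // !sAr.
rewrite [F^`() * G]mulrC [G * F]mulrC -(mulrBr (u ^+ k)); congr (_ * _).
rewrite !scalerDr !scalerA -!natrM opprD addrACA -scalerBl; congr (_ + _).
by rewrite (mulrBr u) !scalerAr.
Qed.

Lemma mup_factor F : F != 0 -> exists2 F1, ~~ root F1 x & F = u ^+ (mup x F) * F1.
Proof.
move=> F0; have [m [F1]] := multiplicity_XsubC F x.
rewrite F0 /= => F1x FE; exists F1 => //.
by rewrite {2}FE mupMr // mup_XsubCX eqxx mulrC.
Qed.

(** The Wronskian is F G times the logarithmic derivative of G^v / F^d, so its vanishing leaves no
    zero or pole of this quotient. *)
Lemma wronsk_eq0_mup F G : F != 0 -> G != 0 -> wronsk v d F G = 0 ->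
  (v * mup x G = d * mup x F)%N.
Proof.
move=> F0 G0; have [F1 F1x {1}->] := mup_factor F0; have [G1 G1x {1}->] := mup_factor G0.
case mnk: (mup x F + mup x G)%N => [|k].
  by move/eqP: mnk; rewrite addn_eq0 => /andP[/eqP-> /eqP->] _; rewrite !muln0.
rewrite (wronsk_local _ _ mnk) => /eqP; rewrite mulf_eq0 expf_eq0 polyXsubC_eq0 andbF /=.
move=> /eqP/(congr1 (horner^~ x)); rewrite !hornerE subrr mul0r addr0 => /eqP.
rewrite !mulf_eq0 (negPf (F1x : F1.[x] != 0)) (negPf (G1x : G1.[x] != 0)) !orbF subr_eq0 => /eqP.
exact: natr_inj0.
Qed.

Lemma wronsk_mup F G : wronsk v d F G != 0 -> root F x ->
  if (v * mup x G == d * mup x F)%N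
  then (mup x F + mup x G <= mup x (wronsk v d F G))%N
  else ((mup x (wronsk v d F G)).+1 == mup x F + mup x G)%N.
Proof.
move=> H0 Fx.
have F0 : F != 0 by apply: contraNneq H0 => ->; rewrite /wronsk deriv0 !mul0r !scaler0 subr0.
have G0 : G != 0 by apply: contraNneq H0 => ->; rewrite /wronsk deriv0 !mulr0 !scaler0 subr0.
have m0 : (0 < mup x F)%N by rewrite -XsubC_dvd // dvdp_XsubCl.
have [F1 F1x FE] := mup_factor F0; have [G1 G1x GE] := mup_factor G0.
case mnk: (mup x F + mup x G)%N => [|k]; first by rewrite -mnk; lia.
have HE := wronsk_local F1 G1 mnk; rewrite -FE -GE in HE.
case: eqP => [vd|/eqP vd].
  by rewrite mup_geq // HE vd subrr scale0r add0r mulrA -exprSr dvdp_mulr.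
rewrite HE mupMl ?mup_XsubCX ?eqxx //; apply: contra vd => /rootP.
rewrite !hornerE subrr mul0r addr0 => /eqP.
rewrite !mulf_eq0 (negPf (F1x : F1.[x] != 0)) (negPf (G1x : G1.[x] != 0)) !orbF subr_eq0 => /eqP.
by move/natr_inj0 => ->.
Qed.
End Local.

Lemma coefM_last F G a b : (size F <= a.+1)%N -> (size G <= b.+1)%N ->
  (F * G)`_(a + b) = F`_a * G`_b.
Proof.
move=> sF sG; rewrite coefM (bigD1 (Ordinal (ltn_addr b (ltnSn a)))) //= addKn.
rewrite big1 ?addr0 // => i; rewrite -val_eqE /= => ia.
have [ai|ai] := ltnP a i.
  by rewrite [F`_i]nth_default ?mul0r // (leq_trans sF).
rewrite [G`__]nth_default ?mulr0 //; apply: leq_trans sG _.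
by move: (nat_of_ord i) ia ai => n na an; lia.
Qed.

(** The analogue of [wronsk_local] at infinity: the coefficient in degree a + b - 1 replaces the
    value at x. *)
Lemma wronsk_coef v d F G a b : (size F <= a.+1)%N -> (size G <= b.+1)%N ->
  (size (wronsk v d F G) <= a + b)%N /\
  (wronsk v d F G)`_(a + b).-1 = ((v * b)%:R - (d * a)%:R) * (F`_a * G`_b).
Proof.
have h (P Q : {poly K}) a' b' : (size P <= a'.+1)%N -> (size Q <= b'.+1)%N ->
    (size (P * Q^`())%R <= a' + b')%N /\ (P * Q^`())`_(a' + b').-1 = (P`_a' * Q`_b') *+ b'.
  case: b' => [|b'] sP sQ.
    have -> : Q^`() = 0 by rewrite (size1_polyC sQ) derivC.
    by rewrite mulr0 size_poly0 mulr0n coef0.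
  have sQ' : (size Q^`() <= b'.+1)%N.
    apply/leq_sizeP => j hj; rewrite coef_deriv nth_default ?mul0rn //.
    exact: leq_trans sQ _.
  split; first by apply: leq_trans (size_polyMleq _ _) _; lia.
  by rewrite addnS /= coefM_last // coef_deriv mulrnAr.
move=> sF sG; have [s1 c1] := h _ _ _ _ sF sG; have [s2 c2] := h _ _ _ _ sG sF.
rewrite /wronsk [F^`() * G]mulrC; split.
  apply: leq_trans (size_polyD _ _) _; rewrite size_polyN geq_max.
  by rewrite !(leq_trans (size_scale_leq _ _)) // addnC.
rewrite coefB !coefZ c1 addnC c2 [G`_b * _]mulrC.
rewrite -[_ *+ b]mulr_natl -[_ *+ a]mulr_natl.
by rewrite ![_%:R * (_%:R * _)]mulrA -!natrM -mulrBl.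
Qed.

Lemma wronsk_eq0_deg v d F G : F != 0 -> G != 0 -> wronsk v d F G = 0 ->
  (v * (size G).-1 = d * (size F).-1)%N.
Proof.
move=> F0 G0 W0.
have [_] := wronsk_coef v d (leqSpred (size F)) (leqSpred (size G)).
rewrite W0 coef0 => /esym/eqP; rewrite -!lead_coefE !mulf_eq0 !lead_coef_eq0.
by rewrite (negPf F0) (negPf G0) !orbF subr_eq0 => /eqP/natr_inj0.
Qed.

Lemma wronsk_deg v d F G : wronsk v d F G != 0 ->
  if (v * (size G).-1 == d * (size F).-1)%N
  then ((size (wronsk v d F G)).-1 + 2 <= (size F).-1 + (size G).-1)%N
  else ((size (wronsk v d F G)).-1.+1 == (size F).-1 + (size G).-1)%N.
Proof.
move=> H0.
have F0 : F != 0 by apply: contraNneq H0 => ->; rewrite /wronsk deriv0 !mul0r !scaler0 subr0.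
have G0 : G != 0 by apply: contraNneq H0 => ->; rewrite /wronsk deriv0 !mulr0 !scaler0 subr0.
have [sH cH] := wronsk_coef v d (leqSpred (size F)) (leqSpred (size G)).
have sH0 : (0 < size (wronsk v d F G))%N by rewrite size_poly_gt0.
case: eqP cH => [->|/eqP vd] cH.
  suff : (size (wronsk v d F G) <= ((size F).-1 + (size G).-1).-1)%N by lia.
  apply/leq_sizeP => j; rewrite leq_eqVlt => /predU1P[<-|lj].
    by rewrite cH subrr mul0r.
  by rewrite nth_default //; apply: leq_trans sH _; lia.
suff : (((size F).-1 + (size G).-1).-1 < size (wronsk v d F G))%N by lia.
rewrite ltnNge; apply: contra vd => /(nth_default 0); rewrite cH => /eqP.
rewrite -!lead_coefE !mulf_eq0 !lead_coef_eq0 (negPf F0) (negPf G0) !orbF.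
by rewrite subr_eq0 => /eqP/natr_inj0->.
Qed.

Lemma sum_mup_le G (t : seq K) : G != 0 -> uniq t ->
  (\sum_(x <- t) mup x G <= (size G).-1)%N.
Proof.
move=> + ut; elim: t ut G => [|x t IH] /=; first by move=> *; rewrite big_nil.
move=> /andP[xt /IH{}IH] G G0; rewrite big_cons.
have [G1 G1x GE] := mup_factor x G0.
have G10 : G1 != 0 by apply: contraNneq G1x => ->; rewrite root0.
have u0 : ('X - x%:P) ^+ mup x G != 0 by rewrite expf_neq0 // polyXsubC_eq0.
rewrite [in leqRHS]GE size_mul // size_exp_XsubC /=.
have -> : (\sum_(y <- t) mup y G = \sum_(y <- t) mup y G1)%N.
  apply: eq_big_seq => y yt; rewrite [in LHS]GE mupM // mup_XsubCX.
  by case: eqP => // xy; rewrite xy yt in xt.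
have := IH _ G10; have : (0 < size G1)%N by rewrite size_poly_gt0.
by move: (\sum_(y <- t) _)%N (size G1) (mup x G) => a b c; lia.
Qed.
End Wronskian.

(** * Edge forms are powers of a linear polynomial *)

Section Edge.
Variable K : closedFieldType.
Hypothesis charK0 : [pchar K] =i pred0.
Implicit Types F G : {poly K}.

(* At a root of F of multiplicity m the order of G is 1 + t m, and likewise
   deg G = 1 + t deg F, for the same rational number t; summing over the roots
   shows that F has at most one. *)
Lemma edge_form F G v d e s :
  (e + s = v + d)%N -> (0 < s)%N -> (0 < v)%N -> (s * (size F).-1 < 2 * v)%N ->
  wronsk v d F G != 0 -> wronsk v e F (wronsk v d F G) = 0 ->
  v <> (s * (size F).-1)%N /\
  exists a, F = lead_coef F *: ('X - a%:P) ^+ (size F).-1.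
Proof.
move=> es s0 v0 sF H0 WH0.
have F0 : F != 0 by apply: contraNneq H0 => ->; rewrite /wronsk deriv0 !mul0r !scaler0 subr0.
have G0 : G != 0 by apply: contraNneq H0 => ->; rewrite /wronsk deriv0 !mulr0 !scaler0 subr0.
have esN n : (e * n + s * n = v * n + d * n)%N by rewrite -!mulnDl es.
(* With H the Wronskian, v deg H = e deg F gives v (deg F + deg G - deg H) = s deg F < 2 v. So the
   degree cannot drop by two or more, and the generic alternative of [wronsk_deg] holds. *)
have [vMdN degE] : (v * (size G).-1 != d * (size F).-1)%N /\
   (v * (size G).-1 + s * (size F).-1 = v + d * (size F).-1)%N.
  have := wronsk_deg charK0 H0; have := wronsk_eq0_deg charK0 F0 H0 WH0.
  move: (size (wronsk v d F G)).-1 (size G).-1 (size F).-1 sF (esN (size F).-1).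
  move=> k M N sN h1 h2; case: eqP => h3 h4; first by nia.
  by split => //; nia.
split=> [vs|]; first by move: vMdN; rewrite vs in degE *; lia.
have [rs FE] := closed_field_poly_normal F.
have F0' := F0; rewrite -lead_coef_eq0 in F0'.
have sz : (size F).-1 = size rs by rewrite FE size_scale // size_prod_XsubC.
have rootE x : root F x = (x \in rs) by rewrite FE rootZ // root_prod_XsubC.
have mupE x : mup x F = count_mem x rs.
  rewrite FE -mul_polyC mupMr; last by rewrite rootC.
  exact: mu_prod_XsubC.
(* The same computation with orders at x: the exceptional alternative of [wronsk_mup] would give s m
   <= 0 for the multiplicity m > 0 of x. *)
have locE x : x \in rs -> (v * mup x G + s * mup x F = v + d * mup x F)%N.
  rewrite -rootE => Fx; have := wronsk_mup charK0 H0 Fx.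
  have := wronsk_eq0_mup charK0 x F0 H0 WH0.
  have : (0 < mup x F)%N by rewrite -XsubC_dvd // dvdp_XsubCl.
  move: (mup x (wronsk v d F G)) (mup x G) (mup x F) (esN (mup x F)) => k r m h1 m0 h2.
  by case: eqP => h3 h4; nia.
have S1 : (size (undup rs) <= 1)%N.
  have cnt : (\sum_(x <- undup rs) mup x F = size rs)%N.
    rewrite -(perm_size (perm_count_undup rs)) size_flatten /shape -map_comp.
    by rewrite sumnE big_map; apply: eq_bigr => x _; rewrite mupE /= size_nseq.
  have := sum_mup_le G0 (undup_uniq rs).
  have : (v * \sum_(x <- undup rs) mup x G + s * size rs = v * size (undup rs) + d * size rs)%N.
    rewrite -cnt !big_distrr -sum1_size big_distrr -!big_split /=.
    by apply: eq_big_seq => x; rewrite mem_undup => /locE ->; rewrite muln1.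
  move=> h2 h1; rewrite -(leq_pmul2l v0) muln1; rewrite -sz in h2.
  have : (v * \sum_(x <- undup rs) mup x G <= v * (size G).-1)%N by rewrite leq_mul.
  by lia.
have [a rsa] : exists a, rs = nseq (size rs) a.
  case: rs S1 {FE sz rootE mupE locE} => [|a t] S1; first by exists 0.
  exists a; apply/all_pred1P/allP => y yt; move: S1; rewrite -mem_undup in yt.
  have : a \in undup (a :: t) by rewrite mem_undup mem_head.
  by case: (undup _) yt => [|b [|]] //; rewrite !inE => /eqP-> /eqP->.
exists a; rewrite {1}FE sz rsa size_nseq; congr (_ *: _).
by rewrite big_nseq; elim: (size rs) => [|n IH]; rewrite ?expr0 // exprS -IH.
Qed.
End Edge.

(** * Linear dependence by counting *)

Lemma exists_kernel (K : fieldType) (T : finType) m (f : T -> 'I_m -> K) :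
  (m < #|T|)%N ->
  exists2 c : T -> K, exists t, c t != 0 & forall k, \sum_t c t * f t k = 0.
Proof.
move=> ltmT; pose M := \matrix_(i < #|T|, k < m) f (enum_val i) k.
have /rowV0Pn[u] : kermx M != 0.
  by rewrite -mxrank_eq0 mxrank_ker subn_eq0 -ltnNge (leq_ltn_trans (rank_leq_col M)).
move=> /sub_kermxP uM u0.
exists (fun t => u 0 (enum_rank t)).
  have [i ui] : exists i, u 0 i != 0.
    apply/existsP; apply: contraR u0; rewrite negb_exists => /forallP h.
    by apply/eqP/rowP => i; rewrite mxE; apply/eqP; rewrite -[_ == _]negbK.
  by exists (enum_val i); rewrite enum_valK.
move=> k; have /rowP/(_ k) := uM; rewrite !mxE => uMk.
rewrite -[RHS]uMk (reindex (@enum_rank T)) /=; last first.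
  by exists enum_val => ? _; rewrite ?enum_rankK ?enum_valK.
by apply: eq_bigr => t _; rewrite mxE enum_rankK.
Qed.

(** * The derivation ad z and its powers *)

Section AdjointAction.
Variables (K : fieldType) (A : algType K).
Implicit Types x y z w u : A.

(** The common consequence of nilpotency and semisimplicity from which a box is constructed; it is
    inherited by the images of z under automorphisms. *)
Definition ad_rich z := exists w,
  (exists2 l : K, l != 0 & w != 0 /\ ad z w = l *: w) \/
  (ad z w != 0 /\ ad z (ad z w) = 0).

Lemma adM z x y : ad z (x * y) = ad z x * y + x * ad z y.
Proof. by rewrite /ad mulrBl mulrBr !mulrA addrA subrK. Qed.

Lemma adMl z x y : ad z x = 0 -> ad z (x * y) = x * ad z y.
Proof. by rewrite adM => ->; rewrite mul0r add0r. Qed.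

Lemma iter_adD z m x y : iter m (ad z) (x + y) = iter m (ad z) x + iter m (ad z) y.
Proof. by elim: m => //= m ->; rewrite adDr. Qed.

Lemma iter_ad0 z m : iter m (ad z) 0 = 0.
Proof. by elim: m => //= m ->; rewrite ad0r. Qed.

Lemma iter_adZ z m c x : iter m (ad z) (c *: x) = c *: iter m (ad z) x.
Proof. by elim: m => //= m ->; rewrite adZr. Qed.

Lemma iter_adMl z m x y : ad z x = 0 -> iter m (ad z) (x * y) = x * iter m (ad z) y.
Proof. by move=> zx; elim: m => //= m ->; rewrite adMl. Qed.

Lemma iter_ad_eigen z w l m : ad z w = l *: w -> iter m (ad z) w = l ^+ m *: w.
Proof.
move=> zw; elim: m => [|m /= ->]; first by rewrite scale1r.
by rewrite adZr zw scalerA -exprSr.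
Qed.

Lemma ad_eigenX z w l j : ad z w = l *: w -> ad z (w ^+ j) = (l *+ j) *: w ^+ j.
Proof.
move=> zw; elim: j => [|j IH]; first by rewrite /ad mulr1 mul1r subrr scale0r.
by rewrite exprS adM zw IH -scalerAl -scalerAr -scalerDl mulrS.
Qed.

(** Leibniz's rule stops after two terms because (ad z)^2 kills w. At m = 0 the truncated [m.-1] is
    multiplied by 0. *)
Lemma iter_ad_nil_mul z w m y : ad z (ad z w) = 0 ->
  iter m (ad z) (w * y) =
  w * iter m (ad z) y + (ad z w * iter m.-1 (ad z) y) *+ m.
Proof.
move=> zzw; elim: m => [|m IH]; first by rewrite mulr0n addr0.
rewrite /= IH adDr adM; rewrite [ad z w * _ + _]addrC -addrA; congr (_ + _).
rewrite mulrS; congr (_ + _); case: m {IH} => [|m]; first by rewrite !mulr0n ad0r.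
by rewrite -!scaler_nat adZr adMl.
Qed.

(** Under ad z the power w^j behaves like the monomial t^j under d/dt, with [z, w] in the place of
    the constant 1. *)
Lemma iter_ad_nilX z w j : ad z (ad z w) = 0 ->
  (forall m, (j < m)%N -> iter m (ad z) (w ^+ j) = 0) /\
  iter j (ad z) (w ^+ j) = ad z w ^+ j *+ j`!.
Proof.
move=> zzw; elim: j => [|j [IH1 IH2]].
  split=> [[//|m] _|//]; elim: m => [|m /= ->]; last by rewrite ad0r.
  by rewrite /= /ad mulr1 mul1r subrr.
split=> [[//|m] jm|].
  by rewrite exprS iter_ad_nil_mul // IH1 ?IH1 // ?mulr0 ?mul0rn ?addr0 // ltnW.
rewrite exprS iter_ad_nil_mul // IH1 // mulr0 add0r /= IH2 mulrnAr -exprS.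
by rewrite -mulrnA mulnC factS.
Qed.

Definition zpoly z n (c : nat -> K) : A := \sum_(i < n) c i *: z ^+ i.

Lemma ad_zpoly z n c : ad z (zpoly z n c) = 0.
Proof.
apply: (big_ind (fun x => ad z x = 0)) => [|x y xz yz|i _]; first exact: ad0r.
  by rewrite adDr xz yz addr0.
by rewrite adZr /ad -exprS -exprSr subrr scaler0.
Qed.

Lemma zpolyZ z n a c : zpoly z n (fun i => a * c i) = a *: zpoly z n c.
Proof. by rewrite /zpoly scaler_sumr; apply: eq_bigr => i _; rewrite scalerA. Qed.
End AdjointAction.

(** * Bounded orbits and noncommuting leading forms *)

Section Bounded.
Variables (K : fieldType) (A : algType K) (p q : A).
Hypothesis hA : weyl_algebra p q.
Hypothesis charK0 : [pchar K] =i pred0.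
Variables r s : nat.
Hypotheses (r_gt0 : (0 < r)%N) (s_gt0 : (0 < s)%N).
Local Notation wle := (wt_le hA r s).
Local Notation lead := (wt_lead hA r s).
Implicit Types x y z w : A.

(** Implied both by being an eigenvector and by being killed by a power of ad z, and stable under
    sums and products, hence valid for all z^i w^j at once. *)
Definition ad_bounded z x := exists C, forall m, wle C (iter m (ad z) x).

Lemma ad_boundedD z x y : ad_bounded z x -> ad_bounded z y -> ad_bounded z (x + y).
Proof.
move=> [C xC] [D yD]; exists (maxn C D) => m; rewrite iter_adD.
by apply: wt_leD; [apply: wt_leW (xC m) | apply: wt_leW (yD m)];
   rewrite (leq_maxl, leq_maxr).
Qed.

Lemma ad_boundedZ z c x : ad_bounded z x -> ad_bounded z (c *: x).
Proof. by move=> [C xC]; exists C => m; rewrite iter_adZ; apply: wt_leZ. Qed.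

Lemma ad_boundedM z x y : ad_bounded z x -> ad_bounded z y -> ad_bounded z (x * y).
Proof.
move=> [C xC] [D yD]; exists (C + D)%N => m; elim: m x y xC yD => [|m IH] x y xC yD.
  by apply: wt_leM; [apply: (xC 0%N) | apply: (yD 0%N)].
rewrite iterSr adM iter_adD; apply: wt_leD; apply: IH => // k; rewrite -iterSr.
  exact: xC.
exact: yD.
Qed.

Lemma ad_bounded_comm z x : ad z x = 0 -> ad_bounded z x.
Proof.
move=> zx; have [C xC] := wt_le_exists hA r s x; exists C => -[//|m].
by rewrite iterSr zx iter_ad0; apply: wt_le0.
Qed.

Lemma ad_boundedX z x j : ad_bounded z x -> ad_bounded z (x ^+ j).
Proof.
move=> bx; elim: j => [|j IH]; last by rewrite exprS; apply: ad_boundedM.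
by apply: ad_bounded_comm; rewrite /ad mulr1 mul1r subrr.
Qed.

Lemma ad_bounded_sum z (I : Type) (t : seq I) (P : pred I) (F : I -> A) :
  (forall i, P i -> ad_bounded z (F i)) -> ad_bounded z (\sum_(i <- t | P i) F i).
Proof.
move=> FP; apply: (big_ind (ad_bounded z)) => //; first by apply/ad_bounded_comm/ad0r.
exact: ad_boundedD.
Qed.

Lemma ad_bounded_eigen z w l : ad z w = l *: w -> ad_bounded z w.
Proof.
move=> zw; have [C wC] := wt_le_exists hA r s w; exists C => m.
by rewrite (iter_ad_eigen _ zw); apply: wt_leZ.
Qed.

Lemma ad_bounded_nil z x m : iter m (ad z) x = 0 -> ad_bounded z x.
Proof.
elim: m x => [|m IH] x; first by move=> /= ->; apply/ad_bounded_comm/ad0r.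
rewrite iterSr => /IH[C xC]; have [D xD] := wt_le_exists hA r s x.
exists (maxn C D) => -[|k]; first by apply: wt_leW xD; rewrite leq_maxr.
by rewrite iterSr; apply: wt_leW (xC k); rewrite leq_maxl.
Qed.

Lemma weyl_mulf_neq0 x y : x != 0 -> y != 0 -> x * y != 0.
Proof.
move=> /(lead_exists hA r_gt0 s_gt0)[v xv lx] /(lead_exists hA r_gt0 s_gt0)[w yw ly].
apply: contraTneq (mulf_neq0 lx ly) => xy0.
by rewrite -leadM // xy0 lead0 eqxx.
Qed.

Lemma weyl_expf_neq0 x j : x != 0 -> x ^+ j != 0.
Proof.
move=> x0; elim: j => [|j IH]; first by rewrite oner_eq0.
by rewrite exprS weyl_mulf_neq0.
Qed.

Section Leading.
Variables (z : A) (v : nat).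
Hypotheses (zv : wle v z) (z0 : lead v z != 0).
Let F := lead v z.

Lemma zpoly_eq0 n c : (0 < v)%N -> zpoly z n c = 0 -> forall i, (i < n)%N -> c i = 0.
Proof.
move=> v0; elim: n => [//|n IH] zn0 i.
suff cn0 : c n = 0.
  rewrite ltnS leq_eqVlt => /predU1P[->//|]; apply: IH.
  by move: zn0; rewrite /zpoly big_ord_recr /= cn0 scale0r addr0.
have := congr1 (lead (n * v)) zn0; rewrite /zpoly big_ord_recr /= lead0 leadD leadZ.
rewrite leadX // lead_sum // big1 ?add0r => [/eqP|k _].
  by rewrite scaler_eq0 expf_eq0 (negPf z0) andbF orbF => /eqP.
rewrite leadZ (lead_small r_gt0 s_gt0 (wt_leX (n := k) zv)) ?scaler0 //.
by rewrite ltn_pmul2r.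
Qed.

(** Induction on the number of powers of w. For an eigenvector, ad z - lJ removes the term with w^J
    and multiplies the j-th one by l (j - J), nonzero for j < J. In the nilpotent case (ad z)^J
    kills all lower powers and leaves J! times [z, w]^J. Since v > 0, z is transcendental over K. *)
Lemma zw_free w : (0 < v)%N ->
  (exists2 l : K, l != 0 & w != 0 /\ ad z w = l *: w) \/
  (ad z w != 0 /\ ad z (ad z w) = 0) ->
  forall J n (c : nat -> nat -> K),
  \sum_(j < J) zpoly z n (c^~ j) * w ^+ j = 0 ->
  forall i j, (i < n)%N -> (j < J)%N -> c i j = 0.
Proof.
move=> v0 hw J n; elim: J => [//|J IH] c S0.
have last0 u : u != 0 -> zpoly z n (c^~ J) * u = 0 ->
    forall i, (i < n)%N -> c i J = 0.
  move=> u0 zu; apply: (zpoly_eq0 (c := c^~ J)) => //.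
  by apply: contra_eq zu => zn0; apply: weyl_mulf_neq0.
case: hw => [[l l0 [w0 zw]]|[zw0 zzw]].
  have cJ i j : (i < n)%N -> (j < J)%N -> c i j = 0.
    move=> ilt jlt; pose c' i j := (l *+ j - l *+ J) * c i j.
    suff /(IH c')/(_ i j ilt jlt)/eqP : \sum_(j < J) zpoly z n (c'^~ j) * w ^+ j = 0.
      rewrite mulf_eq0 subr_eq0 => /orP[|/eqP//].
      rewrite -(mulr_natr l j) -(mulr_natr l J) (inj_eq (mulfI l0)) => /eqP/(natr_inj0 charK0) jJ.
      by rewrite jJ ltnn in jlt.
    have := congr1 (fun x => ad z x - (l *+ J) *: x) S0.
    rewrite /= ad0r scaler0 subr0 => E; rewrite -[RHS]E {E}.
    rewrite big_ord_recr /= adDr adMl ?ad_zpoly // (ad_eigenX _ zw) -scalerAr scalerDr.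
    rewrite opprD addrACA subrr addr0 scaler_sumr.
    rewrite (big_morph (ad z) (adDr z) (ad0r z)) -sumrB; apply: eq_bigr => k _.
    rewrite adMl ?ad_zpoly // (ad_eigenX _ zw) -scalerAr -scalerBl.
    by rewrite scalerAl -zpolyZ.
  move=> i j ilt; rewrite ltnS leq_eqVlt => /predU1P[->|]; last exact: cJ.
  apply: (last0 (w ^+ J)) ilt; first exact: weyl_expf_neq0.
  rewrite big_ord_recr /= in S0; rewrite -[LHS]add0r -[RHS]S0; congr (_ + _).
  rewrite big1 // => k _; rewrite /zpoly big1 ?mul0r // => i' _.
  by rewrite cJ ?scale0r.
have cJ i : (i < n)%N -> c i J = 0.
  move=> ilt; apply: (last0 (ad z w ^+ J *+ J`!)) ilt.
    rewrite -scaler_nat scaler_eq0 negb_or weyl_expf_neq0 // andbT.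
    by rewrite ((pcharf0P K).1 charK0) -lt0n fact_gt0.
  have := congr1 (iter J (ad z)) S0; rewrite iter_ad0 => E; rewrite -[RHS]E {E}.
  rewrite big_ord_recr /= iter_adD iter_adMl ?ad_zpoly // (iter_ad_nilX _ zzw).2.
  rewrite (big_morph _ (iter_adD z J) (iter_ad0 z J)) big1 ?add0r // => k _.
  by rewrite iter_adMl ?ad_zpoly // (iter_ad_nilX _ zzw).1 ?mulr0.
move=> i j ilt; rewrite ltnS leq_eqVlt => /predU1P[->|]; first exact: cJ.
apply: IH => //; move: S0; rewrite big_ord_recr /= => /eqP.
rewrite addr_eq0 => /eqP ->; rewrite /zpoly big1 ?mul0r ?oppr0 // => i' _.
by rewrite cJ ?scale0r.
Qed.

Lemma wronsk_lead d x : (r + s <= v + d)%N -> wle d x ->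
  wronsk v d F (lead d x) = - (r%:R *: lead (v + d - (r + s)) (ad z x)).
Proof.
move=> rsv xd; by rewrite (lead_comm r_gt0 s_gt0 rsv zv xd) opprB.
Qed.

(* Otherwise the leading forms of all elements with bounded ad-orbit would span
   at most a line in each weight, whereas the monomials z^i w^j give a number
   of independent elements which is quadratic in the weight. *)
Lemma noncommuting_lead : (r + s < v)%N -> ad_rich z ->
  exists G d e, [/\ (e + (r + s) = v + d)%N, wronsk v d F G != 0 &
                    wronsk v e F (wronsk v d F G) = 0].
Proof.
move=> rsv [w hw]; apply: contrapT => noedge.
have v0 : (0 < v)%N by lia.
have rN0 : r%:R != 0 :> K by rewrite ((pcharf0P K).1 charK0) -lt0n.
have F0 : F != 0 by [].
(* The weight of (ad z)^m x as long as no bracket of leading forms vanishes. *)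
pose dg d m := (d + m * (v - (r + s)))%N.
have comm x d : ad_bounded z x -> wle d x -> wronsk v d F (lead d x) = 0.
  move=> [C xC] xd.
  have xm m : wle (dg d m) (iter m (ad z) x).
    elim: m => [|m IH]; first by rewrite /dg addn0.
    apply: wt_leW (wt_le_comm r_gt0 s_gt0 zv IH).
    by rewrite /dg mulSn; move: (m * _)%N => t; lia.
  have wl m : wronsk v (dg d m) F (lead (dg d m) (iter m (ad z) x)) =
      (- r%:R) *: lead (dg d m.+1) (iter m.+1 (ad z) x).
    rewrite wronsk_lead ?scaleNr ?(leq_trans (ltnW rsv)) ?leq_addr //.
    suff -> : (dg d m.+1 = v + dg d m - (r + s))%N by [].
    by rewrite /dg mulSn; move: (m * _)%N => t; lia.
  (* By [noedge], a bracket with F that is nonzero has a nonzero bracket with F again; so vanishing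
     propagates back to the first bracket. *)
  have down m : lead (dg d m.+1) (iter m.+1 (ad z) x) = 0 ->
      lead (dg d 1) (iter 1 (ad z) x) = 0.
    elim: m => [//|m IH] lm; apply: IH; apply: contrapT => /eqP lm0; apply: noedge.
    exists (lead (dg d m) (iter m (ad z) x)), (dg d m), (dg d m.+1).
    split; first by rewrite /dg mulSn; move: (m * _)%N => t; lia.
      by rewrite wl scaler_eq0 negb_or oppr_eq0 rN0.
    by rewrite wl wronskZr wl lm !scaler0.
  have := wl 0%N; rewrite /dg addn0 => ->.
  rewrite (down C) ?scaler0 //; apply: (lead_small r_gt0 s_gt0 (xC C.+1)).
  by rewrite /dg; nia.
pose N := (size F).-1.
(* A nonzero form G commuting with F has v deg G = d N, so this single coefficient is its leading
   one: each weight imposes one linear condition. *)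
have vanish x d : ad_bounded z x -> wle d x -> (lead d x)`_((d * N) %/ v) = 0 ->
    lead d x = 0.
  move=> bx xd; apply: contra_eq => G0; rewrite /N.
  by rewrite -(wronsk_eq0_deg charK0 F0 G0 (comm _ _ bx xd)) mulKn // lead_coef_eq0.
have [D wD] := wt_le_exists hA r s w.
have bw : ad_bounded z w.
  by case: hw => [[l _ [_ zw]]|[_ zzw]];
     [apply: ad_bounded_eigen zw | apply: (ad_bounded_nil (m := 2))].
(* The n^2 products have weight at most C, and n^2 = C + 2n exceeds the C + 1 conditions, one for
   each weight up to C. *)
pose n := (v + D).+2; pose C := (n * (v + D))%N.
pose mon (t : 'I_n * 'I_n) := z ^+ t.1 * w ^+ t.2.
have monC t : wle C (mon t).
  apply: (@wt_leW _ _ _ _ _ _ _ (t.1 * v + t.2 * D)%N).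
    by rewrite /C mulnDr leq_add // leq_mul // ltnW.
  by apply: wt_leM; apply: wt_leX.
have monb t : ad_bounded z (mon t).
  by apply: ad_boundedM; apply: ad_boundedX => //; apply: ad_bounded_comm; rewrite /ad subrr.
have [|c [t ct] cker] := @exists_kernel K ('I_n * 'I_n)%type C.+1
    (fun t k => (lead k (mon t))`_((k * N) %/ v)).
  by rewrite card_prod card_ord /C /n; nia.
pose x := \sum_t c t *: mon t.
have bx : ad_bounded z x by apply: ad_bounded_sum => i _; apply: ad_boundedZ.
have lx k : (k <= C)%N -> wle k x -> lead k x = 0.
  move=> kC xk; apply: vanish => //; rewrite lead_sum // coef_sum.
  rewrite -[RHS](cker (Ordinal (kC : (k < C.+1)%N))); apply: eq_bigr => i _.
  by rewrite leadZ coefZ.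
have x0 : x = 0.
  have xk k : (k <= C)%N -> wle (C - k) x.
    elim: k => [_|k IH kC].
      by rewrite subn0; apply: wt_le_sum => i _; apply/wt_leZ/monC.
    have xk := IH (ltnW kC).
    have E : (C - k)%N = (C - k.+1).+1 by lia.
    by rewrite E in xk; apply: (wt_le_lower r_gt0 s_gt0 xk); apply: lx => //; lia.
  have x00 := xk C (leqnn C); rewrite subnn in x00.
  by apply: (wt_le0_lead0 r_gt0 s_gt0 x00); apply: lx.
have := @zw_free w v0 hw n n (fun i j => c (inord i, inord j)) _ t.1 t.2
  (ltn_ord _) (ltn_ord _).
rewrite !inord_val -surjective_pairing => ct0; apply: (elimN eqP ct); apply: ct0.
have xE : x = \sum_i \sum_j c (i, j) *: mon (i, j).
  by rewrite pair_bigA; apply: eq_bigr => -[].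
rewrite -[RHS]x0 xE exchange_big.
apply: eq_bigr => j _; rewrite /zpoly mulr_suml; apply: eq_bigr => i _.
by rewrite !inord_val -scalerAl.
Qed.
End Leading.
End Bounded.

(** * Shifts, Fourier transform and affine automorphisms *)

Section Automorphisms.
Variables (K : fieldType) (A : algType K) (p q : A).
Hypothesis hA : weyl_algebra p q.
Local Notation e i j := (p ^+ i * q ^+ j).

Lemma weyl_hom P Q : Q * P - P * Q = 1 ->
  exists f : {lrmorphism A -> A}, f p = P /\ f q = Q.
Proof. by move=> /(hA.2 A P Q)[f [fp fq _]]; exists f. Qed.

Lemma weyl_cancel (f g : {lrmorphism A -> A}) :
  g (f p) = p -> g (f q) = q -> cancel f g.
Proof.
move=> gfp gfq; pose h : {lrmorphism A -> A} := g \o f.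
exact: (weyl_hom_ext hA (f := h) (g := idfun)).
Qed.

(** Bijectivity provides a mere function as inverse; the universal property, applied to the
    preimages of p and q, makes it a morphism. *)
Lemma weyl_inv (f : {lrmorphism A -> A}) : bijective f ->
  exists g : {lrmorphism A -> A}, [/\ bijective g, cancel f g & cancel g f].
Proof.
move=> [g fK gK].
have [|h [hp hq]] := @weyl_hom (g p) (g q).
  by apply: (can_inj fK); rewrite rmorphB !rmorphM /= !gK (weyl_rel hA) rmorph1.
have hK : cancel h f by apply: weyl_cancel; rewrite ?hp ?hq.
have hE : h =1 g by move=> x; rewrite -[LHS]fK hK.
by exists h; split=> // [|x]; [exists f => // x|]; rewrite hE fK.
Qed.

Lemma shift_aut (a : K) t : exists phi : {lrmorphism A -> A},
  [/\ bijective phi, phi p = p & phi q = q + a *: p ^+ t].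
Proof.
have rel b : (q + b *: p ^+ t) * p - p * (q + b *: p ^+ t) = 1.
  rewrite mulrDl mulrDr -scalerAl -scalerAr -exprS -exprSr opprD addrACA subrr addr0.
  exact: weyl_rel hA.
have [f [fp fq]] := weyl_hom (rel a); have [g [gp gq]] := weyl_hom (rel (- a)).
exists f; split=> //; exists g; apply: weyl_cancel; rewrite ?fp ?gp //.
  by rewrite fq rmorphD /= linearZ /= rmorphXn /= gp gq scaleNr subrK.
by rewrite gq rmorphD /= linearZ /= rmorphXn /= fp fq scaleNr addrK.
Qed.

Lemma fourier_aut : exists phi psi : {lrmorphism A -> A},
  [/\ cancel phi psi, cancel psi phi, phi p = - q /\ phi q = p &
      psi p = q /\ psi q = - p].
Proof.
have [|f [fp fq]] := @weyl_hom (- q) p.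
  by rewrite mulrN mulNr opprK addrC (weyl_rel hA).
have [|g [gp gq]] := @weyl_hom q (- p).
  by rewrite mulrN mulNr opprK addrC (weyl_rel hA).
exists f, g; split=> //; apply: weyl_cancel.
- by rewrite fp rmorphN /= gq opprK.
- by rewrite fq gp.
- by rewrite gp fq.
- by rewrite gq rmorphN /= fp opprK.
Qed.

Lemma affine_aut (a b c d : K) : a * b = 1 -> exists phi : {lrmorphism A -> A},
  [/\ bijective phi, phi p = a *: p + c%:A & phi q = b *: q + d%:A].
Proof.
have rel a' b' c' d' : a' * b' = 1 ->
    (b' *: q + d'%:A) * (a' *: p + c'%:A) - (a' *: p + c'%:A) * (b' *: q + d'%:A) = 1.
  by move=> ab; rewrite -[LHS]/(ad _ _) ad_affine /ad (weyl_rel hA) mulrC ab scale1r.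
move=> ab; have [f [fp fq]] := weyl_hom (rel a b c d ab).
have ba : b * a = 1 by rewrite mulrC.
have [g [gp gq]] := weyl_hom (rel b a (- (b * c)) (- (a * d)) ba).
have fA (h : {lrmorphism A -> A}) x : h x%:A = x%:A by rewrite linearZ /= rmorph1.
exists f; split=> //; exists g; apply: weyl_cancel;
  rewrite ?fp ?fq ?gp ?gq rmorphD /= linearZ /= fA ?fp ?fq ?gp ?gq;
  rewrite scalerDr !scalerA ?ab ?ba scale1r ?mulrN ?mulrA ?ab ?ba ?mul1r.
- by rewrite scaleNr subrK.
- by rewrite scaleNr subrK.
- by rewrite scaleNr addrK.
- by rewrite scaleNr addrK.
Qed.

Lemma wt_le_p r s : wt_le hA r s r p.
Proof.
by have := @wt_le_monom _ _ _ _ hA r s r 1 0; rewrite expr1 expr0 mulr1; apply; lia.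
Qed.

Lemma wt_le_q r s : wt_le hA r s s q.
Proof.
by have := @wt_le_monom _ _ _ _ hA r s s 0 1; rewrite expr1 expr0 mul1r; apply; lia.
Qed.

Lemma lead_p r s : (0 < r)%N -> (0 < s)%N -> wt_lead hA r s r p = 1.
Proof.
move=> r0 s0; have := lead_monom hA r0 s0 r 1 0.
by rewrite expr1 !expr0 mulr1 muln1 muln0 addn0 eqxx.
Qed.

Lemma lead_q r s : (0 < r)%N -> (0 < s)%N -> wt_lead hA r s s q = 'X.
Proof.
move=> r0 s0; have := lead_monom hA r0 s0 s 0 1.
by rewrite !expr1 !expr0 mul1r muln1 muln0 add0n eqxx.
Qed.

Lemma wt_le_morph (psi : {lrmorphism A -> A}) r s x y v z :
  wt_le hA r s x (psi p) -> wt_le hA r s y (psi q) ->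
  wt_le hA x y v z -> wt_le hA r s v (psi z).
Proof.
move=> px qy; move: z; apply: wt_le_ind => [|z z' IH IH'|c i j ijv].
- by rewrite rmorph0; apply: wt_le0.
- by rewrite rmorphD; apply: wt_leD.
rewrite linearZ rmorphM !rmorphXn /=; apply: wt_leZ; apply: wt_leW ijv _.
by rewrite mulnC [(y * j)%N]mulnC; apply: wt_leM; apply: wt_leX.
Qed.

Lemma lead_morph_monom (psi : {lrmorphism A -> A}) r s x y v i j :
  (0 < r)%N -> (0 < s)%N ->
  wt_le hA r s x (psi p) -> wt_le hA r s y (psi q) -> (x * i + y * j <= v)%N ->
  wt_lead hA r s v (psi (e i j)) =
    if (x * i + y * j == v)%N
    then wt_lead hA r s x (psi p) ^+ i * wt_lead hA r s y (psi q) ^+ j else 0.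
Proof.
move=> r0 s0 px qy; rewrite rmorphM !rmorphXn mulnC [(y * j)%N]mulnC.
have le : wt_le hA r s (i * x + j * y) (psi p ^+ i * psi q ^+ j).
  by apply: wt_leM; apply: wt_leX.
case: eqP => [<- _|neq ijv].
  by rewrite leadM ?leadX //; apply: wt_leX.
by apply: (lead_small r0 s0 le); lia.
Qed.

(** For the weights (1, t) the substitution q -> q + a p^t is homogeneous, hence acts on forms, and
    at p = 1 it is a translation of the variable. *)
Lemma shift_lead (phi : {lrmorphism A -> A}) a t v z : (0 < t)%N ->
  phi p = p -> phi q = q + a *: p ^+ t -> wt_le hA 1 t v z ->
  wt_le hA 1 t v (phi z) /\
  wt_lead hA 1 t v (phi z) = wt_lead hA 1 t v z \Po ('X + a%:P).
Proof.
move=> t0 fp fq zv.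
have px : wt_le hA 1 t 1 (phi p) by rewrite fp; apply: wt_le_p.
have ptE : wt_le hA 1 t t (p ^+ t) by have := wt_leX (n := t) (@wt_le_p 1 t); rewrite muln1.
have qx : wt_le hA 1 t t (phi q).
  by rewrite fq; apply: wt_leD; [apply: wt_le_q | apply: wt_leZ].
split; first exact: wt_le_morph zv.
have l1 : wt_lead hA 1 t 1 (phi p) = 1 by rewrite fp lead_p.
have l2 : wt_lead hA 1 t t (phi q) = 'X + a%:P.
  rewrite fq leadD leadZ lead_q //; congr (_ + _).
  have := leadX (ltn0Sn 0) t0 t (@wt_le_p 1 t); rewrite muln1 => ->.
  by rewrite lead_p // expr1n alg_polyC.
move: z zv; apply: wt_le_ind => [|x y IHx IHy|c i j ijv].
- by rewrite rmorph0 !lead0 comp_poly0.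
- by rewrite rmorphD !leadD comp_polyD IHx IHy.
rewrite linearZ /= !leadZ comp_polyZ (lead_morph_monom _ t0 px qx) // l1 l2 lead_monom //.
by case: eqP => _; rewrite ?comp_poly0 // expr1n mul1r comp_Xn_poly.
Qed.

(** Exchanging p and q reverses the coefficients of the form, up to the sign from p -> -q. *)
Lemma fourier_lead (phi : {lrmorphism A -> A}) v z :
  phi p = - q -> phi q = p -> wt_le hA 1 1 v z ->
  wt_le hA 1 1 v (phi z) /\
  forall i, (i <= v)%N ->
    (wt_lead hA 1 1 v (phi z))`_i = (-1) ^+ i * (wt_lead hA 1 1 v z)`_(v - i).
Proof.
move=> fp fq zv.
have px : wt_le hA 1 1 1 (phi p) by rewrite fp; apply/wt_leN/wt_le_q.
have qx : wt_le hA 1 1 1 (phi q) by rewrite fq; apply: wt_le_p.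
split; first exact: wt_le_morph zv.
have l1 : wt_lead hA 1 1 1 (phi p) = - 'X.
  by rewrite fp -scaleN1r leadZ lead_q // scaleN1r.
have l2 : wt_lead hA 1 1 1 (phi q) = 1 by rewrite fq lead_p.
move: z zv; apply: wt_le_ind => [|x y IHx IHy|c i j ijv] k kv.
- by rewrite rmorph0 !lead0 !coef0 mulr0.
- by rewrite rmorphD !leadD !coefD IHx // IHy // mulrDr.
rewrite linearZ /= !leadZ !coefZ mulrCA; congr (_ * _).
rewrite (lead_morph_monom _ _ px qx) // l1 l2 lead_monom // !mul1n.
case: eqP => [ijE|_]; last by rewrite !coef0 mulr0.
rewrite expr1n mulr1 -scaleN1r exprZn coefZ !coefXn.
have -> : (v - k == j)%N = (k == i)%N by lia.
by case: eqP => [->|_]; rewrite ?mulr0.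
Qed.

Lemma weyl_boxP k n z : weyl_box p q k n z <->
  pqcoef hA z k n != 0 /\
  forall i j, pqcoef hA z i j != 0 -> (i <= k)%N && (j <= n)%N.
Proof.
split=> [[a akn ->]|[zkn zbox]].
  have aE i j : (i <= k)%N && (j <= n)%N ->
      pqcoef hA (\sum_(i < k.+1) \sum_(j < n.+1) a i j *: (e i j)) i j = a i j.
    move=> /andP[ik jn]; rewrite pqcoef_sum (bigD1 (Ordinal (ik : i < k.+1)%N)) //=.
    rewrite pqcoef_sum (bigD1 (Ordinal (jn : j < n.+1)%N)) //= pqcoefZ pqcoef_monom.
    rewrite !eqxx mulr1 !big1 ?addr0 // => [i'|j'] ne.
      rewrite pqcoef_sum big1 // => j' _; rewrite pqcoefZ pqcoef_monom.
      by move: ne; rewrite -val_eqE /= eq_sym => /negPf ->; rewrite mulr0.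
    rewrite pqcoefZ pqcoef_monom.
    by move: ne; rewrite -val_eqE /= eq_sym => /negPf ->; rewrite andbF mulr0.
  split; first by rewrite aE ?leqnn.
  move=> i j; apply: contraR => ijkn; apply/eqP.
  rewrite pqcoef_sum big1 // => i' _; rewrite pqcoef_sum big1 // => j' _.
  rewrite pqcoefZ pqcoef_monom; case: eqP => [ii'|]; last by rewrite mulr0.
  case: eqP => [jj'|]; last by rewrite mulr0.
  by case/negP: ijkn; rewrite ii' jj' -[(i' <= k)%N]ltnS -[(j' <= n)%N]ltnS !ltn_ord.
exists (pqcoef hA z) => //.
have [m mP] := weyl_expand hA z; pose M := (m + k + n).+1.
have /mP {1}-> : (m <= M)%N by rewrite /M; lia.
have kM : (k.+1 <= M)%N by rewrite /M; lia.
have nM : (n.+1 <= M)%N by rewrite /M; lia.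
rewrite (big_ord_widen M (fun i => \sum_(j < n.+1) pqcoef hA z i j *: (e i j)) kM).
rewrite [RHS]big_mkcond /=; apply: eq_bigr => i _.
have zero i' j' : ~~ ((i' <= k) && (j' <= n))%N -> pqcoef hA z i' j' = 0.
  by move=> h; apply/eqP; apply: contraR h => /zbox.
case: ltnP => ik; last first.
  by rewrite big1 // => j _; rewrite zero ?scale0r // leqNgt ik.
rewrite (big_ord_widen M (fun j => pqcoef hA z i j *: (e i j)) nM) [RHS]big_mkcond /=.
apply: eq_bigr => j _; case: ltnP => jn //.
by rewrite zero ?scale0r // negb_and orbC -ltnNge jn.
Qed.
End Automorphisms.

Lemma leq_div_cross x y d1 d2 n : (0 < n)%N -> (d1 %| n)%N -> (d2 %| n)%N ->
  (x * (n %/ d1) <= y * (n %/ d2))%N -> (x * d2 <= y * d1)%N.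
Proof.
move=> n0 dn1 dn2 h; rewrite -(leq_pmul2r n0).
have -> : (x * d2 * n = x * (n %/ d1) * (d1 * d2))%N by rewrite -{1}(divnK dn1); lia.
have -> : (y * d1 * n = y * (n %/ d2) * (d1 * d2))%N by rewrite -{1}(divnK dn2); lia.
by rewrite leq_mul2r h orbT.
Qed.

(** * Existence of a box in the orbit *)

Section Existence.
Variables (K : closedFieldType) (A : algType K) (p q : A).
Hypothesis hA : weyl_algebra p q.
Hypothesis charK0 : [pchar K] =i pred0.
Local Notation coef := (pqcoef hA).
Local Notation wle := (wt_le hA).
Local Notation lead := (wt_lead hA).
Implicit Types z : A.

Lemma ad_rich_morph (phi : {lrmorphism A -> A}) z :
  injective phi -> ad_rich z -> ad_rich (phi z).
Proof.
move=> inj [w hw]; exists (phi w).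
have adE x : ad (phi z) (phi x) = phi (ad z x) by rewrite /ad rmorphB !rmorphM.
have phi0 x : (phi x == 0) = (x == 0).
  by apply/eqP/eqP => [|->]; [rewrite -{1}(rmorph0 phi) => /inj | rewrite rmorph0].
case: hw => [[l l0 [w0 zw]]|[zw0 zzw]]; [left; exists l => //|right].
  by rewrite phi0 w0 adE zw linearZ.
by rewrite !adE phi0 zw0 zzw rmorph0.
Qed.

Lemma wt0_central r s z w : (0 < r)%N -> (0 < s)%N -> wle r s 0 z -> ad z w = 0.
Proof.
move=> r0 s0; move: z; apply: wt_le_ind => [|x y IHx IHy|c i j].
- exact: ad0l.
- by rewrite adDl IHx IHy addr0.
rewrite leqn0 addn_eq0 !muln_eq0 (gtn_eqF r0) (gtn_eqF s0) => /andP[/eqP-> /eqP->].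
by rewrite adZl /ad !mul1r !mulr1 subrr scaler0.
Qed.

Lemma ad_rich_wt_gt0 z : ad_rich z -> ~ wle 1 1 0 z.
Proof.
move=> [w hw] /(wt0_central w (ltn0Sn 0) (ltn0Sn 0)) zw.
case: hw => [[l l0 [w0 zwE]]|[]]; last by rewrite zw eqxx.
by move: zwE; rewrite zw => /esym/eqP; rewrite scaler_eq0 (negPf l0) (negPf w0).
Qed.

Lemma rich_edge_form r s v z : (0 < r)%N -> (0 < s)%N ->
  wle r s v z -> lead r s v z != 0 -> (r + s < v)%N -> ad_rich z ->
  ((r + s) * (size (lead r s v z)).-1 < 2 * v)%N ->
  v <> ((r + s) * (size (lead r s v z)).-1)%N /\
  exists a, lead r s v z =
    lead_coef (lead r s v z) *: ('X - a%:P) ^+ (size (lead r s v z)).-1.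
Proof.
move=> r0 s0 zv z0 rsv rich sz.
have [G [d [e [es W0 WW0]]]] := noncommuting_lead charK0 r0 s0 zv z0 rsv rich.
by apply: (edge_form charK0 es _ _ _ W0 WW0) => //; lia.
Qed.

(** If q^v occurs, moving a root of the form to 0 removes p^v, and the Fourier transform turns this
    into the absence of q^v. The degree is then below v, as the edge lemma requires for the weights
    (1, 1). *)
Lemma drop_lead_degree v z : (0 < v)%N -> wle 1 1 v z -> lead 1 1 v z != 0 ->
  exists phi : {lrmorphism A -> A},
    [/\ bijective phi, wle 1 1 v (phi z), lead 1 1 v (phi z) != 0 &
        (size (lead 1 1 v (phi z)) <= v)%N].
Proof.
move=> v0 zv z0; set F := lead 1 1 v z in z0.
have [sF|sF] := leqP (size F) v.
  by exists idfun; split=> //; exists id.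
have /closed_rootP[a Fa] : size F != 1%N by apply/eqP; lia.
have [f [fbij fp fq]] := shift_aut hA a 1; rewrite expr1 in fq.
have [g [g' [gK g'K [gp gq] _]]] := fourier_aut hA.
have [fv fl] := shift_lead (t := 1) isT fp fq zv.
have [gv gl] := fourier_lead gp gq fv.
exists (g \o f : {lrmorphism A -> A}) => /=; split=> //.
- by apply: bij_comp fbij; exists g'.
- have : lead 1 1 v (f z) != 0.
    by rewrite fl comp_poly2_eq0 // size_XaddC.
  apply: contra_neq => l0; apply/polyP => i; rewrite coef0.
  have [iv|iv] := leqP i v; last by rewrite nth_default // (leq_trans (size_poly _ _)).
  have := gl (v - i)%N (leq_subr _ _); rewrite l0 coef0 subKn // => /esym/eqP.
  by rewrite mulf_eq0 signr_eq0 => /eqP.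
apply/leq_sizeP => j; rewrite leq_eqVlt => /predU1P[<-|vj]; last first.
  by rewrite nth_default // (leq_trans (size_poly _ _)).
rewrite gl // subnn fl -horner_coef0 horner_comp !hornerE.
by move/rootP: Fa => ->; rewrite mulr0.
Qed.

Lemma monomial_lead v z : (0 < v)%N -> ad_rich z -> wle 1 1 v z -> lead 1 1 v z != 0 ->
  exists phi : {lrmorphism A -> A}, exists N (c : K),
    [/\ bijective phi, wle 1 1 v (phi z), c != 0, (N < v)%N &
        lead 1 1 v (phi z) = c *: 'X^N].
Proof.
move=> v0 rich zv z0.
have [f [fbij fv f0 sf]] := drop_lead_degree v0 zv z0.
have frich : ad_rich (f z) by apply: ad_rich_morph => //; apply: bij_inj.
set F := lead 1 1 v (f z) in f0 sf *.
have sF : (0 < size F)%N by rewrite size_poly_gt0.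
have [a FE] : exists a, F = lead_coef F *: ('X - a%:P) ^+ (size F).-1.
  (* For v <= 2 the edge lemma does not apply, but F has degree below v, so it is constant or
     linear. *)
  have [v2|v2] := ltnP (1 + 1) v.
    by have [|_ //] := rich_edge_form (ltn0Sn 0) (ltn0Sn 0) fv f0 v2 frich _; rewrite -/F; lia.
  have [s1|s1] := leqP (size F) 1.
    have sE : (size F).-1 = 0%N by lia.
    by exists 0; rewrite lead_coefE sE expr0 alg_polyC; apply: size1_polyC.
  have sF2 : size F = 2%N by lia.
  exists (- F`_0 / F`_1); rewrite lead_coefE sF2 /= expr1.
  have F1 : F`_1 != 0 by move: f0; rewrite -lead_coef_eq0 lead_coefE sF2.
  apply/polyP => i; rewrite coefZ coefB coefX coefC.
  case: i => [|[|i]] /=; last by rewrite nth_default ?sF2 // subr0 mulr0.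
    by rewrite sub0r mulNr opprK mulrC divfK.
  by rewrite subr0 mulr1.
have [g [gbij gp gq]] := shift_aut hA a 1; rewrite expr1 in gq.
have [gv gl] := shift_lead (t := 1) isT gp gq fv.
exists (g \o f : {lrmorphism A -> A}), (size F).-1, (lead_coef F) => /=; split=> //.
- exact: bij_comp.
- by rewrite lead_coef_eq0.
- by rewrite prednK.
rewrite gl -/F {1}FE comp_polyZ rmorphXn /= comp_polyB comp_polyX comp_polyC.
by rewrite addrK.
Qed.

(* The quotient by j - b of the abscissa a - i is minimised after multiplication
   by n`!, which keeps it in nat. *)
Lemma steepest_edge a b z : wle 1 1 (a + b) z ->
  (forall i j, coef z i j != 0 -> (i + j = a + b)%N -> j = b) ->
  (exists i j, coef z i j != 0 /\ (b < j)%N) ->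
  exists r s i1 j1, [/\ (0 < r < s)%N, coef z i1 j1 != 0, (b < j1)%N,
     (r * i1 + s * j1 = r * a + s * b)%N /\ (r = j1 - b)%N & wle r s (r * a + s * b) z].
Proof.
move=> zab top [i0 [j0 [zij bj]]].
have tot i j : coef z i j != 0 -> (i + j <= a + b)%N.
  by apply: contraR; rewrite -ltnNge => h; apply/eqP/zab; rewrite !mul1n.
have above i j : coef z i j != 0 -> (b < j)%N -> (i + j < a + b)%N.
  move=> h bj'; rewrite ltn_neqAle tot // andbT; apply/eqP => /(top _ _ h) jb.
  by rewrite jb ltnn in bj'.
have [n nP] := pqcoef_bound hA z.
pose P (t : 'I_n * 'I_n) := (coef z t.1 t.2 != 0) && (b < t.2)%N.
have /andP[i0n j0n] := nP _ _ zij.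
have P0 : P (Ordinal i0n, Ordinal j0n) by rewrite /P /= zij.
case: (arg_minnP (fun t : 'I_n * 'I_n => (a - t.1) * (n`! %/ (t.2 - b)))%N P0).
move=> [i1 j1] /= /andP[/= z1 bj1] min1.
have ab1 := above _ _ z1 bj1.
have minE i j : coef z i j != 0 -> (b < j)%N ->
    ((a - i1) * (j - b) <= (a - i) * (j1 - b))%N.
  move=> zij' bj'; have /andP[iN jN] := nP _ _ zij'.
  have := min1 (Ordinal iN, Ordinal jN); rewrite /P /= zij' bj' => /(_ isT).
  have d1 : (j1 - b %| n`!)%N.
    by apply: dvdn_fact; rewrite subn_gt0 bj1 (leq_trans (leq_subr _ _)) // ltnW.
  have d2 : (j - b %| n`!)%N.
    by apply: dvdn_fact; rewrite subn_gt0 bj' (leq_trans (leq_subr _ _)) // ltnW.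
  exact: leq_div_cross (fact_gt0 n) d1 d2.
(* These weights are normal to the edge from (a, b) to (i1, j1); r < s because i1 + j1 < a + b. *)
exists (j1 - b)%N, (a - i1)%N, i1, j1; split=> //; first by lia.
  by split=> //; nia.
move=> i j; apply: contraTeq => zij'; rewrite -leqNgt.
have [jb|bj'] := leqP j b; last by have := minE _ _ zij' bj'; have := above _ _ zij' bj'; nia.
have := tot _ _ zij'; nia.
Qed.

(* Along an edge of weights r < s the form is c (q - al)^N with al <> 0, which
   forces b = 0 and r | s; then q -> q + al p^(s/r) lowers the total degree. *)
Lemma bounded_or_reducible a b z (c : K) : (0 < a)%N -> ad_rich z ->
  wle 1 1 (a + b) z -> c != 0 -> lead 1 1 (a + b) z = c *: 'X^b ->
  (forall i j, coef z i j != 0 -> (j <= b)%N) \/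
  (exists2 phi : {lrmorphism A -> A}, bijective phi & wle 1 1 (a + b).-1 (phi z)).
Proof.
move=> a0 rich zab c0 zE.
have top i j : coef z i j != 0 -> (i + j = a + b)%N -> j = b.
  rewrite -(coef_lead hA (ltn0Sn 0) (ltn0Sn 0)) !mul1n => + ijE.
  by rewrite ijE zE coefZ coefXn; case: (j =P b) => // _; rewrite mulr0 eqxx.
have zab0 : coef z a b != 0.
  rewrite -(coef_lead hA (ltn0Sn 0) (ltn0Sn 0)) !mul1n zE coefZ coefXn eqxx.
  by rewrite mulr1.
have tot i j : coef z i j != 0 -> (i + j <= a + b)%N.
  by apply: contraR; rewrite -ltnNge => h; apply/eqP/zab; rewrite !mul1n.
case: (pselect (exists i j, coef z i j != 0 /\ (b < j)%N)) => [ex|nex]; last first.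
  by left=> i j zij; rewrite leqNgt; apply/negP => bj; apply: nex; exists i, j.
right; have [r [s [i1 [j1 [/andP[r0 rs] z1 bj1 [eqV rE] zV]]]]] := steepest_edge zab top ex.
have s0 : (0 < s)%N by lia.
set V := (r * a + s * b)%N in eqV zV.
pose F := lead r s V z.
have Fb : F`_b != 0 by rewrite /F coef_lead.
have Fj1 : F`_j1 != 0 by rewrite /F -eqV coef_lead.
(* Since r < s, a point of the edge line below (a, b) has total degree larger than a + b. *)
have Flow j : (j < b)%N -> F`_j = 0.
  move=> jb; apply/eqP; apply: contraT => Fj.
  have [i iV] := lead_neq0 Fj; rewrite /F -iV coef_lead // in Fj.
  by have := tot _ _ Fj; rewrite /V in iV; nia.
have F0 : F != 0 by apply: contraNneq Fb => ->; rewrite coef0.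
have sF : (0 < size F)%N by rewrite size_poly_gt0.
have j1N : (j1 <= (size F).-1)%N.
  by rewrite -ltnS prednK // ltnNge; apply: contra Fj1 => /(nth_default 0) ->.
have N0 : (0 < (size F).-1)%N by apply: leq_trans j1N; apply: leq_ltn_trans bj1.
have sN : (s * (size F).-1 <= V)%N.
  have : F`_(size F).-1 != 0 by rewrite -lead_coefE lead_coef_eq0.
  by move=> /lead_neq0[i <-]; rewrite leq_addl.
have [al FE] : exists al, F = lead_coef F *: ('X - al%:P) ^+ (size F).-1.
  (* Let N be the degree of F. As r < s and s N <= V, one has (r + s) N < 2 V; and if V <= r + s,
     then N = 1. *)
  have [V2|V2] := ltnP (r + s) V.
    have [|_ //] := rich_edge_form r0 s0 zV F0 V2 rich.
    by rewrite -/F; nia.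
  have sF2 : size F = 2%N.
    suff : ((size F).-1 < 2)%N by lia.
    by rewrite -(ltn_pmul2l s0); lia.
  exists (- F`_0 / F`_1); rewrite lead_coefE sF2 /= expr1.
  have F1 : F`_1 != 0 by move: F0; rewrite -lead_coef_eq0 lead_coefE sF2.
  apply/polyP => i; rewrite coefZ coefB coefX coefC.
  case: i => [|[|i]] /=; last by rewrite nth_default ?sF2 // subr0 mulr0.
    by rewrite sub0r mulNr opprK mulrC divfK.
  by rewrite subr0 mulr1.
have al0 : al != 0.
  apply: contraNneq Fb => al0; rewrite FE al0 subr0 coefZ coefXn.
  by case: (b =P _) => [bN|]; [lia | rewrite mulr0].
have lc0 : lead_coef F != 0 by rewrite lead_coef_eq0.
have b0 : b = 0%N.
  case: (posnP b) => // /Flow/eqP; rewrite -horner_coef0 FE !hornerE.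
  by rewrite mulf_eq0 expf_eq0 oppr_eq0 (negPf lc0) (negPf al0) andbF.
(* In characteristic 0 the coefficient of X in (X - al)^N is nonzero; it comes from a lattice point
   (i, 1) on the edge through (a, 0), so r divides s. *)
have F1 : F`_1 != 0.
  have -> : F`_1 = F^`().[0] by rewrite horner_coef0 coef_deriv.
  rewrite FE derivZ deriv_exp derivXsubC mul1r -scaler_nat !hornerE.
  rewrite !mulf_neq0 ?expf_neq0 ?oppr_eq0 //.
  by rewrite ((pcharf0P K).1 charK0) -lt0n.
have [i1' i1V] := lead_neq0 F1.
pose t := (a - i1')%N.
have sE : s = (r * t)%N.
  by rewrite /V b0 muln0 addn0 muln1 in i1V; rewrite /t mulnBr -i1V addKn.
have t2 : (1 < t)%N by rewrite -(ltn_pmul2l r0) muln1 -sE.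
have t0 : (0 < t)%N := ltnW t2.
have VE : V = (r * a)%N by rewrite /V b0 muln0 addn0.
have z1t : wle 1 t a z.
  by move=> i j h; apply: zV; rewrite VE sE -mulnA -mulnDr ltn_pmul2l // -[i]mul1n.
have l1t : lead 1 t a z = F.
  apply: lead_ext => // [i j ijE|j Fj].
    by rewrite /F VE -ijE mulnDr mul1n mulnA -sE coef_lead.
  have [i iV] := lead_neq0 Fj; exists i; apply/eqP.
  by rewrite -(eqn_pmul2l r0) -VE -iV sE mul1n mulnDr mulnA.
have [f [fbij fp fq]] := shift_aut hA al t; exists f => //.
have [fv fl] := shift_lead t0 fp fq z1t.
have fa0 : coef (f z) a 0 = 0.
  have := coef_lead hA (ltn0Sn 0) t0 (f z) a 0; rewrite mul1n muln0 addn0 fl l1t => <-.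
  rewrite FE comp_polyZ rmorphXn /= comp_polyB comp_polyX comp_polyC addrK.
  by rewrite coefZ coefXn; case: eqP => [E|_]; [rewrite -E in N0 | rewrite mulr0].
(* Since t >= 2, p^a is the only monomial of (1, t)-weight at most a with total degree a or more,
   and its coefficient is now 0. *)
move=> i j; rewrite b0 addn0 !mul1n => h.
have [j0|j0] := posnP j; last first.
  have tj : (2 * j <= t * j)%N by rewrite leq_mul2r t2 orbT.
  by apply: fv; move: (t * j)%N h j0 tj => u; clear; lia.
have [->|ia] := eqVneq i a; first by rewrite j0.
by apply: fv; rewrite mul1n j0 muln0 addn0; rewrite j0 in h; move: h ia; clear; lia.
Qed.

Lemma exists_box z : ad_rich z -> exists k n,
  [/\ (k, n) <> (0, 0)%N, (n <= k)%N & exists2 phi : {lrmorphism A -> A}, bijective phi &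
      weyl_box p q k n (phi z)].
Proof.
have [v zv] := wt_le_exists hA 1 1 z; move: z zv.
elim: v => [|v IH] z zv rich; first by case: (ad_rich_wt_gt0 rich).
have reduce (f : {lrmorphism A -> A}) : bijective f -> wle 1 1 v (f z) ->
    exists k n, [/\ (k, n) <> (0, 0)%N, (n <= k)%N & exists2 phi : {lrmorphism A -> A},
      bijective phi & weyl_box p q k n (phi z)].
  move=> fbij fv; have [|k [n [kn nk [g gbij gbox]]]] := IH _ fv.
    by apply: ad_rich_morph rich; apply: bij_inj.
  by exists k, n; split=> //; exists (g \o f : {lrmorphism A -> A}) => //; apply: bij_comp.
have [z0|z0] := eqVneq (lead 1 1 v.+1 z) 0.
  apply: (reduce idfun); first by exists id.
  exact: (wt_le_lower (ltn0Sn 0) (ltn0Sn 0) zv z0).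
have [f [N [c [fbij fv c0 Nv fl]]]] := monomial_lead (ltn0Sn v) rich zv z0.
have [g [g' [gK g'K [gp gq] [g'p g'q]]]] := fourier_aut hA.
have gbij : bijective g by exists g'.
have swap b x (d : K) : (b <= v.+1)%N -> wle 1 1 v.+1 x -> lead 1 1 v.+1 x = d *: 'X^b ->
    d != 0 -> wle 1 1 v.+1 (g x) /\
    exists2 d', d' != 0 & lead 1 1 v.+1 (g x) = d' *: 'X^(v.+1 - b).
  move=> bv xv xl d0; have [gv gl] := fourier_lead gp gq xv; split=> //.
  exists ((-1) ^+ (v.+1 - b) * d); first by rewrite mulf_eq0 signr_eq0.
  apply/polyP => i; rewrite coefZ coefXn.
  have [iv|iv] := leqP i v.+1; last first.
    rewrite nth_default; last by rewrite (leq_trans (size_poly _ _)).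
    by case: eqP => [|_]; [lia | rewrite mulr0].
  rewrite gl // xl coefZ coefXn.
  have -> : (v.+1 - i == b)%N = (i == v.+1 - b)%N by lia.
  by case: eqP => [->|_]; rewrite ?mulr0 ?mulr1.
(* The Fourier transform exchanges the two exponents of the top monomial, so b <= a may be
   assumed. *)
have [h [a [b [hbij hv [abE ab] a0 [d d0 hl]]]]] : exists (h : {lrmorphism A -> A}) a b,
    [/\ bijective h, wle 1 1 v.+1 (h z), (a + b = v.+1)%N /\ (b <= a)%N, (0 < a)%N &
      exists2 d : K, d != 0 & lead 1 1 v.+1 (h z) = d *: 'X^b].
  have [le|gt] := leqP N (v.+1 - N).
    by exists f, (v.+1 - N)%N, N; split=> //; [split=> //; lia | lia | exists c].
  have [gv [d d0 gl]] := swap _ _ _ (ltnW Nv) fv fl c0.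
  exists (g \o f : {lrmorphism A -> A}), N, (v.+1 - N)%N; split=> //; try lia.
  - exact: bij_comp.
  - by exists d.
have hrich : ad_rich (h z) by apply: ad_rich_morph rich; apply: bij_inj.
rewrite -abE in hv hl.
have [hb|[e ebij ev]] := bounded_or_reducible a0 hrich hv d0 hl; last first.
  by apply: (reduce (e \o h : {lrmorphism A -> A})); [apply: bij_comp | rewrite abE in ev].
have hab0 : coef (h z) a b != 0.
  rewrite -(coef_lead hA (ltn0Sn 0) (ltn0Sn 0)) !mul1n hl coefZ coefXn eqxx.
  by rewrite mulr1.
suff ha : (forall i j, coef (h z) i j != 0 -> (i <= a)%N) \/
    (exists2 phi : {lrmorphism A -> A}, bijective phi & wle 1 1 v (phi z)).
  case: ha => [ha|[phi phibij phiv]]; last exact: reduce phiv.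
  exists a, b; split=> //; first by case=> aE; rewrite aE in a0.
  by exists h => //; apply/(weyl_boxP hA); split=> // i j zij; rewrite (ha _ j) // (hb i).
have [b0|b0] := posnP b.
  left=> i j; apply: contraR; rewrite -ltnNge => ai; apply/eqP/hv.
  by rewrite b0 !mul1n; lia.
rewrite abE in hv hl; have bv : (b <= v.+1)%N by lia.
have [gv [d' d'0 gl]] := swap _ _ _ bv hv hl d0.
have abE' : (b + a = v.+1)%N by rewrite addnC.
rewrite -abE addnK abE -abE' in gl; rewrite -abE' in gv.
have grich : ad_rich (g (h z)) by apply: ad_rich_morph hrich; apply: bij_inj.
have [ga|[e ebij ev]] := bounded_or_reducible b0 grich gv d'0 gl; last first.
  right; exists (e \o (g \o h) : {lrmorphism A -> A}); last by rewrite abE' in ev.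
  by apply: bij_comp => //; apply: bij_comp.
left=> i j; apply: contraR; rewrite -ltnNge => ai; apply/eqP.
(* The bound on the exponent of q in the Fourier image becomes the bound on the exponent of p: g'
   carries the weights (0, 1) to (1, 0). *)
have g'1 : wle 1 0 0 (g' p) by rewrite g'p; apply: wt_le_q.
have g'2 : wle 1 0 1 (g' q) by rewrite g'q; apply/wt_leN/wt_le_p.
have ga' : wle 0 1 a (g (h z)).
  by move=> i' j' aj; apply/eqP; apply: contraTT aj => /ga; rewrite mul0n mul1n -leqNgt.
have := wt_le_morph g'1 g'2 ga'; rewrite gK; apply.
by rewrite mul1n mul0n addn0.
Qed.
End Existence.

(** * Uniqueness and rigidity of boxes *)

Section Uniqueness.
Variables (K : closedFieldType) (A : algType K) (p q : A).
Hypothesis hA : weyl_algebra p q.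
Hypothesis charK0 : [pchar K] =i pred0.
Local Notation coef := (pqcoef hA).
Local Notation wle := (wt_le hA).
Local Notation lead := (wt_lead hA).
Local Notation box := (weyl_box p q).
Implicit Types z : A.

Lemma wt_unique r s v w z : (0 < r)%N -> (0 < s)%N ->
  wle r s v z -> lead r s v z != 0 -> wle r s w z -> lead r s w z != 0 -> v = w.
Proof.
move=> r0 s0 zv lv zw lw.
have le u u' : wle r s u z -> lead r s u' z != 0 -> (u' <= u)%N.
  by move=> zu; apply: contraR; rewrite -ltnNge => /(lead_small r0 s0 zu) ->.
by apply/eqP; rewrite eqn_leq !le.
Qed.

Lemma box_wt r s k n z : box k n z -> wle r s (r * k + s * n) z.
Proof.
move=> /(weyl_boxP hA)[_ zb] i j; apply: contraTeq => /zb/andP[ik jn].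
by rewrite -leqNgt leq_add // leq_mul.
Qed.

Lemma box_lead r s k n z : (0 < r)%N -> (0 < s)%N -> box k n z ->
  lead r s (r * k + s * n) z = coef z k n *: 'X^n.
Proof.
move=> r0 s0 /(weyl_boxP hA)[zkn zb]; apply: lead_ext => // [i j ijE|j].
  rewrite coefZ coefXn; case: eqP => [jn|jn].
    by rewrite mulr1; congr coef => //; rewrite jn in ijE; apply/eqP;
       rewrite -(eqn_pmul2l r0) -(eqn_add2r (s * n)) ijE.
  rewrite mulr0; apply/eqP; apply: contraT => /zb/andP[ik jn'].
  by exfalso; apply: jn; nia.
rewrite coefZ coefXn; case: (j =P n) => [->|]; last by rewrite mulr0 eqxx.
by exists k.
Qed.

(* The corner monomial dominates all others for every choice of positive
   weights of phi p and phi q. *)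
Lemma box_morph_lead (phi : {lrmorphism A -> A}) r s x y k n z :
  (0 < r)%N -> (0 < s)%N -> (0 < x)%N -> (0 < y)%N ->
  wle r s x (phi p) -> wle r s y (phi q) -> box k n z ->
  wle r s (x * k + y * n) (phi z) /\
  lead r s (x * k + y * n) (phi z) =
    coef z k n *: (lead r s x (phi p) ^+ k * lead r s y (phi q) ^+ n).
Proof.
move=> r0 s0 x0 y0 px qy zb; have zw := @box_wt x y _ _ _ zb.
split; first exact: wt_le_morph zw.
have {zb} := box_lead x0 y0 zb; set c := coef z k n; set v := (x * k + y * n)%N in zw *.
move=> lz.
have [m mP] := weyl_expand hA z.
pose g i j := coef z i j *: (if (x * i + y * j == v)%N
   then lead r s x (phi p) ^+ i * lead r s y (phi q) ^+ j else 0).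
have M : (k < m + k.+1 + n)%N by lia.
have N : (n < m + k.+1 + n)%N by lia.
have {1}-> := mP (m + k.+1 + n)%N ltac:(lia).
rewrite rmorph_sum /= lead_sum //.
have -> : \sum_(i < m + k.+1 + n) lead r s v
      (phi (\sum_(j < m + k.+1 + n) coef z i j *: (p ^+ i * q ^+ j))) =
    \sum_(i < m + k.+1 + n) \sum_(j < m + k.+1 + n) g i j.
  apply: eq_bigr => i _; rewrite rmorph_sum /= lead_sum //; apply: eq_bigr => j _.
  rewrite linearZ /= leadZ /g; have [ij|ij] := leqP (x * i + y * j) v.
    by rewrite (lead_morph_monom r0 s0 px qy).
  by rewrite (zw _ _ ij) !scale0r.
have g0 i j : (i, j) != (k, n) -> g i j = 0.
  move=> ne; rewrite /g; case: eqP => [ijv|_]; last by rewrite scaler0.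
  suff -> : coef z i j = 0 by rewrite scale0r.
  rewrite -(coef_lead hA x0 y0) ijv lz coefZ coefXn; case: eqP => [jn|_]; last by rewrite mulr0.
  case/eqP: ne; rewrite jn in ijv *; congr (_, _); apply/eqP.
  by rewrite -(eqn_pmul2l x0) -(eqn_add2r (y * n)) ijv.
rewrite (bigD1 (Ordinal M)) //= (bigD1 (Ordinal N)) //= /g eqxx !big1 ?addr0 //.
  move=> i; rewrite -val_eqE /= => ik; rewrite big1 // => j _.
  by apply: g0; rewrite xpair_eqE (negPf ik).
by move=> j; rewrite -val_eqE /= => jn; apply: g0; rewrite xpair_eqE (negPf jn) andbF.
Qed.

(** An image of weight 0 would be scalar, contradicting the commutation relation. *)
Lemma aut_wt_gt0 (phi : {lrmorphism A -> A}) r s : (0 < r)%N -> (0 < s)%N ->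
  injective phi ->
  (exists x, [/\ (0 < x)%N, wle r s x (phi p) & lead r s x (phi p) != 0]) /\
  (exists y, [/\ (0 < y)%N, wle r s y (phi q) & lead r s y (phi q) != 0]).
Proof.
move=> r0 s0 inj.
have rel : ad (phi q) (phi p) = 1.
  by rewrite /ad -!rmorphM -rmorphB (weyl_rel hA) rmorph1.
have nz x : ad x (phi p) = 1 \/ ad (phi q) x = 1 -> x != 0.
  by case=> h; apply: contraNneq (oner_neq0 A) => x0; rewrite -h x0 ?ad0l ?ad0r.
split.
  have [x px lx] := lead_exists hA r0 s0 (nz _ (or_intror rel)).
  exists x; split=> //; rewrite lt0n; apply: contraNneq (oner_neq0 A) => x0.
  rewrite x0 in px; rewrite -rel -oppr_eq0 /ad opprB -[X in X == 0]/(ad _ _).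
  by rewrite (wt0_central _ r0 s0 px).
have [y qy ly] := lead_exists hA r0 s0 (nz _ (or_introl rel)).
exists y; split=> //; rewrite lt0n; apply: contraNneq (oner_neq0 A) => y0.
by rewrite y0 in qy; rewrite -rel (wt0_central _ r0 s0 qy).
Qed.

Lemma dvd_Xn_monom (f : {poly K}) n : f %| 'X^n -> exists2 c, c != 0 & exists m, f = c *: 'X^m.
Proof.
move=> fX; have : 'X^n = ('X - 0%:P) ^+ n :> {poly K} by rewrite subr0.
move=> Xn; rewrite Xn in fX; have [m _ ] := dvdp_exp_XsubCP fX.
rewrite subr0 => /eqpfP fE; exists (lead_coef f).
  by rewrite lead_coef_eq0; apply: contraTneq fX => ->; rewrite dvd0p expf_neq0 // polyXsubC_eq0.
by exists m; rewrite [LHS]fE lead_coefXn divr1.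
Qed.

Lemma corner_exponents (phi : {lrmorphism A -> A}) r s k n k' n' z :
  (0 < r)%N -> (0 < s)%N -> (0 < k)%N -> injective phi ->
  box k n z -> box k' n' (phi z) ->
  exists a b c d, [/\ coef (phi p) a b != 0, wle r s (r * a + s * b) (phi p),
    k' = (k * a + n * c)%N, n' = (k * b + n * d)%N &
    (0 < n)%N -> coef (phi q) c d != 0 /\ wle r s (r * c + s * d) (phi q)].
Proof.
move=> r0 s0 k0 inj zb fzb; have [fkn _] := (weyl_boxP hA _ _ _).1 fzb.
have [zkn _] := (weyl_boxP hA _ _ _).1 zb.
have [[x [x0 px lx]] [y [y0 qy ly]]] := aut_wt_gt0 r0 s0 inj.
have [fv fl] := box_morph_lead r0 s0 x0 y0 px qy zb.
have fl' := box_lead r0 s0 fzb; have fv' := @box_wt r s _ _ _ fzb.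
have E : (x * k + y * n = r * k' + s * n')%N.
  apply: (wt_unique r0 s0 fv _ fv').
    by rewrite fl scaler_eq0 mulf_eq0 !expf_eq0 (negPf zkn) (negPf lx) (negPf ly) !andbF.
  by rewrite fl' scaler_eq0 (negPf fkn) expf_eq0 polyX_eq0 andbF.
rewrite E fl' in fl.
have dvd f : f %| lead r s x (phi p) ^+ k * lead r s y (phi q) ^+ n -> f %| 'X^n'.
  by move=> fd; rewrite -(dvdpZr _ _ fkn) fl dvdpZr.
have [|c1 c10 [b lP]] := @dvd_Xn_monom (lead r s x (phi p)) n'.
  by apply: dvd; rewrite -(prednK k0) exprS -mulrA dvdp_mulIl.
have [a abx] : exists a, (r * a + s * b)%N = x.
  by apply: (@lead_neq0 _ _ _ _ hA r s x (phi p)); rewrite lP coefZ coefXn eqxx mulr1.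
have Pab : coef (phi p) a b != 0.
  by rewrite -(coef_lead hA r0 s0) abx lP coefZ coefXn eqxx mulr1.
have expE (u w : K) i j : u != 0 -> u *: 'X^i = w *: 'X^j -> i = j.
  move=> u0 /polyP/(_ i); rewrite !coefZ !coefXn eqxx mulr1; case: eqP => // _ u0'.
  by rewrite u0' mulr0 eqxx in u0.
have [n0|n0] := posnP n.
  have nE : n' = (k * b)%N.
    apply: expE fkn _; rewrite fl n0 expr0 mulr1 lP exprZn scalerA -exprM mulnC.
    by rewrite [(k * b)%N]mulnC.
  (* For n = 0 the leading form of phi q does not enter the product; c and d are multiplied by 0. *)
  exists a, b, 0%N, 0%N; rewrite !n0 abx; split=> //; last by rewrite mul0n addn0.
  rewrite mul0n addn0; apply/eqP; rewrite -(eqn_pmul2l r0).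
  by rewrite n0 muln0 addn0 nE -abx in E; apply/eqP; nia.
have [|c2 c20 [d lQ]] := @dvd_Xn_monom (lead r s y (phi q)) n'.
  by apply: dvd; rewrite -(prednK n0) [_ ^+ n.-1.+1]exprS mulrCA dvdp_mulIl.
have [c cdy] : exists c, (r * c + s * d)%N = y.
  by apply: (@lead_neq0 _ _ _ _ hA r s y (phi q)); rewrite lQ coefZ coefXn eqxx mulr1.
have Qcd : coef (phi q) c d != 0.
  by rewrite -(coef_lead hA r0 s0) cdy lQ coefZ coefXn eqxx mulr1.
have nE : n' = (k * b + n * d)%N.
  apply: expE fkn _; rewrite fl lP lQ !exprZn -!exprM -scalerAl -scalerAr !scalerA -exprD.
  by rewrite [(k * b)%N]mulnC [(n * d)%N]mulnC.
exists a, b, c, d; rewrite abx cdy; split=> //.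
apply/eqP; rewrite -(eqn_pmul2l r0); apply/eqP.
by rewrite nE -abx -cdy in E; nia.
Qed.

(** With M above all exponents of phi p and phi q, the weights (1, M) select the largest exponent of
    q and (M, 1) that of p. So a1 <= a2, b2 <= b1 and likewise for phi q; as both choices give the
    same k' and n', equality holds and both maxima lie at one monomial. *)
Lemma aut_box (phi : {lrmorphism A -> A}) k n k' n' z :
  (0 < k)%N -> injective phi -> box k n z -> box k' n' (phi z) ->
  exists a b c d, [/\ box a b (phi p), k' = (k * a + n * c)%N,
    n' = (k * b + n * d)%N & (0 < n)%N -> box c d (phi q)].
Proof.
move=> k0 inj zb fzb.
have [n1 n1P] := pqcoef_bound hA (phi p); have [n2 n2P] := pqcoef_bound hA (phi q).
pose M := (n1 + n2).+1.
have [a1 [b1 [c1 [d1 [P1 wP1 k1 e1 Q1]]]]] :=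
  corner_exponents (ltn0Sn 0) (ltn0Sn _ : 0 < M)%N k0 inj zb fzb.
have [a2 [b2 [c2 [d2 [P2 wP2 k2 e2 Q2]]]]] :=
  corner_exponents (ltn0Sn _ : 0 < M)%N (ltn0Sn 0) k0 inj zb fzb.
have corner x a b a' b' m : (m < M)%N ->
    (forall i j, coef x i j != 0 -> (i < m)%N && (j < m)%N) ->
    coef x a b != 0 -> coef x a' b' != 0 ->
    wle 1 M (1 * a + M * b) x -> wle M 1 (M * a' + 1 * b') x ->
    forall i j, coef x i j != 0 -> (i <= a')%N && (j <= b)%N.
  move=> mM bd /bd/andP[am bm] /bd/andP[a'm b'm] w1 w2 i j xij.
  have /andP[im jm] := bd _ _ xij; apply/andP; split.
    rewrite leqNgt; apply: contra xij => h; apply/eqP/w2.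
    have : (M * a' + M <= M * i)%N by rewrite -mulnSr leq_mul2l h orbT.
    by move: (M * a')%N (M * i)%N => u w; lia.
  rewrite leqNgt; apply: contra xij => h; apply/eqP/w1.
  have : (M * b + M <= M * j)%N by rewrite -mulnSr leq_mul2l h orbT.
  by move: (M * b)%N (M * j)%N => u w; lia.
have cP := corner _ _ _ _ _ _ (_ : n1 < M)%N n1P P1 P2 wP1 wP2.
have {}cP := cP ltac:(rewrite /M; lia).
have /andP[a12 _] := cP _ _ P1; have /andP[_ b21] := cP _ _ P2.
have cQ : (0 < n)%N -> [/\ (c1 <= c2)%N, (d2 <= d1)%N &
    forall i j, coef (phi q) i j != 0 -> (i <= c2)%N && (j <= d1)%N].
  move=> n0; have [Q1' wQ1] := Q1 n0; have [Q2' wQ2] := Q2 n0.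
  have := corner _ _ _ _ _ _ (_ : n2 < M)%N n2P Q1' Q2' wQ1 wQ2.
  move=> /(_ ltac:(rewrite /M; lia)) cQ; split=> //.
    by have /andP[] := cQ _ _ Q1'.
  by have /andP[] := cQ _ _ Q2'.
have nc : (n * c1 <= n * c2)%N by case: (posnP n) => [->//|/cQ[h _ _]]; rewrite leq_mul2l h orbT.
have nd : (n * d2 <= n * d1)%N by case: (posnP n) => [->//|/cQ[_ h _]]; rewrite leq_mul2l h orbT.
have ka : (k * a1 <= k * a2)%N by rewrite leq_mul2l a12 orbT.
have kb : (k * b2 <= k * b1)%N by rewrite leq_mul2l b21 orbT.
have aE : a1 = a2 by apply/eqP; rewrite -(eqn_pmul2l k0) eqn_leq ka; lia.
have bE : b1 = b2 by apply/eqP; rewrite -(eqn_pmul2l k0) eqn_leq kb andbT; lia.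
exists a1, b1, c1, d1; split=> //.
  by apply/(weyl_boxP hA); split=> //; rewrite {1}aE.
move=> n0; have [h1 h2 h3] := cQ n0; have [Q1' _] := Q1 n0.
apply/(weyl_boxP hA); split=> // i j /h3; suff -> : c1 = c2 by [].
by apply/eqP; rewrite -(eqn_pmul2l n0) eqn_leq nc; lia.
Qed.

(* Apply phi^-1: in total degree, p = phi^-1 (phi p) has weight at least a + b. *)
Lemma generator_box (phi : {lrmorphism A -> A}) x a b : bijective phi ->
  x = p \/ x = q -> box a b (phi x) -> (a, b) = (1, 0)%N \/ (a, b) = (0, 1)%N.
Proof.
move=> bij hx xb; have [psi [psibij fK _]] := weyl_inv hA bij.
have [[u [u0 pu lu]] [v [v0 qv lv]]] :=
  aut_wt_gt0 (ltn0Sn 0) (ltn0Sn 0) (bij_inj psibij).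
have [xv xl] := box_morph_lead (ltn0Sn 0) (ltn0Sn 0) u0 v0 pu qv xb.
have [xab _] := (weyl_boxP hA _ _ _).1 xb; rewrite fK in xv xl.
have E : (u * a + v * b = 1)%N.
  apply: (wt_unique (ltn0Sn 0) (ltn0Sn 0) xv (z := x)).
  - by rewrite xl scaler_eq0 mulf_eq0 !expf_eq0 (negPf xab) (negPf lu) (negPf lv) !andbF.
  - by case: hx => ->; [apply: wt_le_p | apply: wt_le_q].
  - by case: hx => ->; rewrite ?lead_p ?lead_q ?oner_neq0 ?polyX_eq0.
have : (a + b <= 1)%N by rewrite -E leq_add // leq_pmull.
case: a b {xb xv xl xab} E => [|[|a]] [|[|b]] //; last by left.
  by rewrite !muln0.
by right.
Qed.

Lemma box10 z : box 1 0 z -> exists a c, z = a *: p + c%:A.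
Proof.
move=> [a _ ->]; exists (a 1%N 0%N), (a 0%N 0%N).
by rewrite big_ord_recr !big_ord1 /= !expr0 expr1 !mulr1 addrC.
Qed.

Lemma box01 z : box 0 1 z -> exists a c, z = a *: q + c%:A.
Proof.
move=> [a _ ->]; exists (a 0%N 1%N), (a 0%N 0%N).
by rewrite big_ord1 big_ord_recr big_ord1 /= !expr0 expr1 !mul1r addrC.
Qed.

Lemma box_rigid (phi : {lrmorphism A -> A}) k n k' n' z : bijective phi ->
  (0 < k)%N -> (n <= k)%N -> (n' <= k')%N -> box k n z -> box k' n' (phi z) ->
  (k', n') = (k, n) /\ ((n < k)%N ->
     exists2 psi : {lrmorphism A -> A}, G0' p q psi & phi z = psi z).
Proof.
move=> bij k0 nk nk' zb fzb.
have rel : ad (phi q) (phi p) = 1.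
  by rewrite /ad -!rmorphM -rmorphB (weyl_rel hA) rmorph1.
have [a [b [c [d [Pab kE nE Qcd]]]]] := aut_box k0 (bij_inj bij) zb fzb.
have nocomm : ad (phi q) (phi p) <> 0.
  by rewrite rel; apply/eqP; apply: oner_neq0.
have [n0|n0] := posnP n.
  rewrite n0 !mul0n !addn0 in kE nE.
  have [[aE bE]|[aE bE]] := generator_box bij (or_introl erefl) Pab; last first.
    by move: nk'; rewrite kE nE aE bE; lia.
  split; first by rewrite kE nE aE bE n0 muln1 muln0.
  move=> _; rewrite aE bE in Pab; have [a1 [c1 PE]] := box10 Pab.
  have a10 : a1 != 0.
    by apply: contra_not_neq nocomm => a10; rewrite PE a10 scale0r add0r ad_algr.
  (* For n = 0, z is a polynomial in p, so only phi p matters and phi q may be replaced by a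
     multiple of q. *)
  have [psi [psibij pp pq]] := affine_aut hA c1 0 (divff a10 : a1 * a1^-1 = 1).
  exists psi; first by split=> //; exists a1, a1^-1, c1, 0; rewrite divff.
  have zw : wle 0 1 0 z by have := @box_wt 0 1 _ _ _ zb; rewrite n0.
  move: z zw {zb fzb}; apply: wt_le_ind => [|x y IHx IHy|c' i j].
  - by rewrite !rmorph0.
  - by rewrite !rmorphD /= IHx IHy.
  rewrite mul0n mul1n add0n leqn0 => /eqP->; rewrite !linearZ /= expr0 mulr1 !rmorphXn /=.
  by rewrite PE pp.
have Qcd' := Qcd n0.
have [[aE bE]|[aE bE]] := generator_box bij (or_introl erefl) Pab;
have [[cE dE]|[cE dE]] := generator_box bij (or_intror erefl) Qcd'.
- rewrite aE bE in Pab; rewrite cE dE in Qcd'.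
  have [a1 [c1 PE]] := box10 Pab; have [a2 [c2 QE]] := box10 Qcd'.
  by case: nocomm; rewrite PE QE ad_affine /ad subrr scaler0.
- split=> [|_]; first by rewrite kE nE aE bE cE dE !muln1 !muln0 addn0.
  exists phi => //; split=> //.
  rewrite aE bE in Pab; rewrite cE dE in Qcd'.
  have [a1 [c1 PE]] := box10 Pab; have [a2 [c2 QE]] := box01 Qcd'.
  exists a1, a2, c1, c2; split=> //.
  move: rel; rewrite PE QE ad_affine /ad (weyl_rel hA) mulrC => /eqP.
  rewrite -subr_eq0 -[X in _ - X]scale1r -scalerBl.
  by rewrite scaler_eq0 oner_eq0 orbF subr_eq0 => /eqP.
(* Here phi exchanges p and q up to affine maps, so (k', n') = (n, k). *)
- have kn : k = n by move: nk'; rewrite kE nE aE bE cE dE; lia.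
  split=> [|]; last by rewrite kn ltnn.
  by rewrite kE nE aE bE cE dE !muln1 !muln0 addn0 kn.
rewrite aE bE in Pab; rewrite cE dE in Qcd'.
have [a1 [c1 PE]] := box01 Pab; have [a2 [c2 QE]] := box01 Qcd'.
by case: nocomm; rewrite PE QE ad_affine /ad subrr scaler0.
Qed.
End Uniqueness.

(** * Dixmier classes and their boxes *)

Section DixmierClasses.
Variables (K : closedFieldType) (A : algType K) (p q : A).
Hypothesis hA : weyl_algebra p q.
Hypothesis charK0 : [pchar K] =i pred0.
Local Notation coef := (pqcoef hA).
Local Notation wle := (wt_le hA).
Local Notation lead := (wt_lead hA).
Local Notation box := (weyl_box p q).
Implicit Types z w x : A.

(** If z commutes with p and q, the brackets of its leading form F with them give F' = 0 and v F =
    0, impossible for v > 0 in characteristic 0. *)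
Lemma noncentral z : nonscalar z -> exists x, ad z x <> 0.
Proof.
move=> nz; apply: contrapT => /forallNP h.
have {}h x : ad z x = 0 by apply: contrapT; apply: h.
apply: nz; have [z0|z0] := eqVneq z 0; first by exists 0 => //; rewrite z0 /= scale0r.
have [v zv lz] := lead_exists hA (ltn0Sn 0) (ltn0Sn 0) z0.
have [v0|v0] := posnP v.
  rewrite v0 in zv; exists (coef z 0 0) => //=; apply: (pqcoef_inj (hA := hA)) => i j.
  have := pqcoef_monom hA 0 0 i j; rewrite !expr0 mulr1 pqcoefZ => ->.
  case: (i =P 0%N) => [->|i0]; last by rewrite andFb mulr0 zv //; lia.
  by case: (j =P 0%N) => [->|j0]; rewrite ?mulr1 // andbF mulr0 zv //; lia.
set F := lead 1 1 v z in lz.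
have W x G : wle 1 1 1 x -> lead 1 1 1 x = G -> wronsk v 1 F G = 0.
  move=> x1 <-; rewrite (wronsk_lead (ltn0Sn 0) (ltn0Sn 0) zv _ x1) ?h ?lead0 ?scaler0 ?oppr0 //.
  by rewrite leq_add2r.
have /eqP := W _ _ (@wt_le_p _ _ _ _ hA 1 1) (lead_p hA (ltn0Sn 0) (ltn0Sn 0)).
rewrite /wronsk -polyC1 derivC !mulr0 scaler0 sub0r oppr_eq0 mulr1 scale1r => /eqP F'0.
have /eqP := W _ _ (@wt_le_q _ _ _ _ hA 1 1) (lead_q hA (ltn0Sn 0) (ltn0Sn 0)).
rewrite /wronsk derivX mulr1 F'0 mul0r scaler0 subr0 scaler_eq0 (negPf lz) orbF.
by rewrite ((pcharf0P K).1 charK0) eqn0Ngt v0.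
Qed.

Lemma nilpotent_witness z : is_nilpotent z ->
  exists w, ad z w <> 0 /\ ad z (ad z w) = 0.
Proof.
move=> hz; have [x [m xm zx]] : exists x, exists2 m, iter m (ad z) x = 0 & ad z x <> 0.
  case: hz => [[nz Nz]|[nz Nz _]].
    have [x zx] := noncentral nz.
    have : ad_nil z x by rewrite Nz.
    by move=> [m _ /= xm]; exists x, m.
  apply: contrapT => /forallNP h; apply: Nz; apply/seteqP; split=> x /=.
    move=> [m _ /= xm]; apply: contrapT => zx; apply: (h x); by exists m.
  by move=> zx; exists 1%N.
elim: m x xm zx => [|m IH] x xm zx; first by case: zx; move: xm => /= ->; rewrite ad0r.
rewrite iterSr in xm; have [zzx|/eqP zzx] := eqVneq (ad z (ad z x)) 0; first by exists x.
exact: IH xm zzx.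
Qed.

(** If 0 were the only eigenvalue, D(z) would be C(z), and D(z) = A would make z central. *)
Lemma semisimple_witness z : is_semisimple z ->
  exists (l : K) w, [/\ l != 0, w != 0 & ad z w = l *: w].
Proof.
move=> hz; apply: contrapT => h.
have ev0 l : ad_eigenvalue z l -> l = 0.
  move=> [w w0 /= /eqP]; rewrite subr_eq0 => /eqP zw; apply/eqP; apply: contrapT => /negP l0.
  by apply: h; exists l, w.
have Dz : ad_diag z = ad_ker z.
  apply/seteqP; split=> x /=.
    move=> [m [l [v [lv ->]]]]; rewrite /ad_ker /=.
    rewrite (big_morph (ad z) (adDr z) (ad0r z)) big1 // => i _.
    by have [/ev0 li0] := lv i; rewrite /ad_eigenspace /= li0 scale0r subr0.
  move=> zx; have e0 : ad_eigenvalue z 0.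
    by exists 1; rewrite ?oner_neq0 // /ad_eigenspace /= scale0r subr0 /ad mulr1 mul1r subrr.
  exists 1%N, (fun=> 0), (fun=> x); split=> [_|]; last by rewrite big_ord1.
  by split=> //; rewrite /ad_eigenspace /= scale0r subr0.
case: hz => [[nz DT]|[_ + _]]; last by rewrite Dz.
have [x zx] := noncentral nz; apply: zx.
have Dx : ad_diag z x by rewrite DT.
by rewrite Dz in Dx.
Qed.

Lemma classes_rich z : is_nilpotent z \/ is_semisimple z -> ad_rich z.
Proof.
case=> [/nilpotent_witness[w [zw zzw]]|/semisimple_witness[l [w [l0 w0 zw]]]].
  by exists w; right; split=> //; apply/eqP.
by exists w; left; exists l.
Qed.

Lemma ad_morph (phi : {lrmorphism A -> A}) z x : ad (phi z) (phi x) = phi (ad z x).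
Proof. by rewrite /ad rmorphB !rmorphM. Qed.

Lemma ad_diag_morph (phi : {lrmorphism A -> A}) z x : injective phi ->
  ad_diag z x -> ad_diag (phi z) (phi x).
Proof.
move=> inj [m [l [v [lv ->]]]]; exists m, l, (phi \o v); split=> [i|]; last by rewrite rmorph_sum.
have es y a : ad_eigenspace z a y -> ad_eigenspace (phi z) a (phi y).
  by rewrite /ad_eigenspace /= ad_morph -linearZ -rmorphB => ->; rewrite rmorph0.
have [[w w0 zw] vi] := lv i; split; last exact: es.
exists (phi w); last exact: es.
by apply: contra_neq w0; rewrite -{1}(rmorph0 phi) => /inj.
Qed.

Lemma ad_diagD z x y : ad_diag z x -> ad_diag z y -> ad_diag z (x + y).
Proof.
move=> [m [l [v [lv ->]]]] [m' [l' [v' [lv' ->]]]].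
exists (m + m')%N, (fun i => match split i with inl j => l j | inr j => l' j end),
  (fun i => match split i with inl j => v j | inr j => v' j end); split=> [i|].
  by case: (split i).
rewrite big_split_ord; congr (_ + _); apply: eq_bigr => i _.
  by rewrite (unsplitK (inl i)).
by rewrite (unsplitK (inr i)).
Qed.

Lemma ad_diag_bounded r s z x : ad_diag z x -> ad_bounded hA r s z x.
Proof.
move=> [m [l [v [lv ->]]]]; apply: ad_bounded_sum => i _.
have [_ /eqP] := lv i; rewrite subr_eq0 => /eqP; exact: ad_bounded_eigen.
Qed.

Lemma ad_pq_monom (a b : K) i j :
  ad (a *: (p * q) + b%:A) (p ^+ i * q ^+ j) = (a *+ i - a *+ j) *: (p ^+ i * q ^+ j).
Proof.
have zp : ad (a *: (p * q) + b%:A) p = a *: p.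
  by rewrite adDl ad_algl addr0 adZl /ad -mulrA -mulrBr (weyl_rel hA) mulr1.
have zq : ad (a *: (p * q) + b%:A) q = (- a) *: q.
  rewrite adDl ad_algl addr0 adZl /ad scaleNr -scalerN mulrA -mulrBl -opprB.
  by rewrite (weyl_rel hA) mulN1r.
rewrite adM (ad_eigenX _ zp) (ad_eigenX _ zq) -scalerAl -scalerAr -scalerDl.
by rewrite mulNrn.
Qed.

Lemma ad_pq_diag (a b : K) x : ad_diag (a *: (p * q) + b%:A) x.
Proof.
elim: (weyl_span hA x) => [c i j|y y' _ IH _ IH']; last exact: ad_diagD.
have m0 : p ^+ i * q ^+ j != 0.
  apply: contraNneq (oner_neq0 K) => m0.
  by have := pqcoef_monom hA i j i j; rewrite m0 pqcoef0 !eqxx => ->.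
exists 1%N, (fun=> a *+ i - a *+ j), (fun=> c *: (p ^+ i * q ^+ j)).
split=> [_|]; last by rewrite big_ord1.
split; first by exists (p ^+ i * q ^+ j); rewrite // /ad_eigenspace /= ad_pq_monom subrr.
by rewrite /ad_eigenspace /= adZr ad_pq_monom !scalerA mulrC subrr.
Qed.

(** On coefficients ad z is diagonal, so its square has the same kernel. *)
Lemma ad_pq_nil (a b : K) w : let z := a *: (p * q) + b%:A in
  ad z (ad z w) = 0 -> ad z w = 0.
Proof.
move=> z; have cE x i j : coef (ad z x) i j = (a *+ i - a *+ j) * coef x i j.
  elim: (weyl_span hA x) => [c k l|y y' _ IH _ IH'].
    rewrite adZr ad_pq_monom !pqcoefZ pqcoef_monom.
    by case: eqP => [->|_]; [case: eqP => [->|_]|]; rewrite /= ?mulr0 // !mulr1 mulrC.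
  by rewrite adDr (pqcoefD _ (ad z y)) (pqcoefD _ y) IH IH' mulrDr.
move=> zzw; apply: (pqcoef_inj (hA := hA)) => i j; rewrite pqcoef0.
have /eqP := pqcoef0 hA i j; rewrite -zzw !cE !mulf_eq0 orbA orbb => /orP[]/eqP ->.
  by rewrite mul0r.
by rewrite mulr0.
Qed.

(** Completing the product: a11 p q + a10 p + a01 q is a11 (p + a01 / a11) (q + a10 / a11) up to a
    scalar. *)
Lemma box11_form z : box 1 1 z -> exists (tau : {lrmorphism A -> A}) a b,
  bijective tau /\ tau (a *: (p * q) + b%:A) = z.
Proof.
move=> [a a11 ->].
have [tau [bij tp tq]] := affine_aut hA (a 0%N 1%N / a 1%N 1%N) (a 1%N 0%N / a 1%N 1%N)
  (mulr1 (1 : K)).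
exists tau, (a 1%N 1%N), (a 0%N 0%N - a 0%N 1%N * a 1%N 0%N / a 1%N 1%N); split=> //.
rewrite rmorphD /= !linearZ /= rmorph1 rmorphM /= tp tq !scale1r.
rewrite !big_ord_recr !big_ord0 /= !expr0 !expr1 !mulr1 !mul1r !add0r.
rewrite mulrDl !mulrDr mulr_algr mulr_algl mulr_algl !scalerDr !scalerA.
have aK (x : K) : a 1%N 1%N * (x / a 1%N 1%N) = x by rewrite mulrCA divff // mulr1.
have rearr (X P Q c d : A) : X + P + (Q + c) + (d - c) = d + Q + (P + X).
  rewrite -(addrA _ (Q + c)) -(addrA Q) [c + _]addrC subrK.
  by rewrite addrC [Q + d]addrC [X + P]addrC.
by rewrite !aK [_ * (a 1%N 0%N / _)]mulrA scalerBl rearr.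
Qed.

(** For the weights (1, 1) the leading form of (ad z)^m p is a nonzero multiple of a monomial of
    weight 1 + m (k + n - 2), which tends to infinity. *)
Lemma box_growth k n z : (0 < n)%N -> (n <= k)%N -> (2 < k + n)%N ->
  box k n z -> ~ ad_bounded hA 1 1 z p.
Proof.
move=> n0 nk kn2 zb [C pC].
have z0 : coef z k n != 0 by have [] := (weyl_boxP hA _ _ _).1 zb.
have zv : wle 1 1 (k + n) z by have := @box_wt _ _ _ _ hA 1 1 _ _ _ zb; rewrite !mul1n.
have zl : lead 1 1 (k + n) z = coef z k n *: 'X^n.
  by have := box_lead hA (ltn0Sn 0) (ltn0Sn 0) zb; rewrite !mul1n.
pose w m := (1 + m * (k + n - 2))%N.
have wS m : (k + n + w m - (1 + 1) = w m.+1)%N.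
  by rewrite /w mulSn; move: (m * _)%N => u; lia.
have wP m : wle 1 1 (w m) (iter m (ad z) p).
  elim: m => [|m IH]; first exact: wt_le_p.
  by rewrite -wS /=; apply: wt_le_comm.
have wL m : exists2 c : K, c != 0 & lead 1 1 (w m) (iter m (ad z) p) = c *: 'X^(m * n.-1).
  elim: m => [|m [c c0 lm]]; first by exists 1; rewrite ?oner_neq0 // lead_p // scale1r.
  have := wronsk_lead (ltn0Sn 0) (ltn0Sn 0) zv _ (wP m).
  rewrite wS scale1r lm zl => /(_ ltac:(lia)) E.
  have WE : wronsk (k + n) (w m) (coef z k n *: 'X^n) (c *: 'X^(m * n.-1)) =
      (coef z k n * c * ((k + n) * (m * n.-1))%:R - coef z k n * c * (w m * n)%:R) *:
      'X^(m.+1 * n.-1).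
    have derX i j : 'X^i * ('X^j)^`() = j%:R *: 'X^((i + j).-1) :> {poly K}.
      rewrite derivXn -scaler_nat -scalerAr.
      by case: j => [|j]; rewrite ?scale0r // -exprD addnS.
    rewrite /wronsk !derivZ -!scalerAl -!scalerAr derX [_^`() * _]mulrC derX.
    have -> : (n + m * n.-1).-1 = (m.+1 * n.-1)%N.
      by rewrite mulSn; move: (m * n.-1)%N => u; lia.
    have -> : (m * n.-1 + n).-1 = (m.+1 * n.-1)%N.
      by rewrite mulSn; move: (m * n.-1)%N => u; lia.
    rewrite !scalerA -scalerBl; congr (_ *: _).
    have perm (x y u t : K) : x * y * u * t = y * u * (x * t).
      by rewrite -!mulrA mulrCA; congr (_ * _); rewrite mulrCA.
    by rewrite !perm -!natrM.
  rewrite WE in E; exists (- (coef z k n * c *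
      ((k + n) * (m * n.-1))%:R - coef z k n * c * (w m * n)%:R)).
    rewrite oppr_eq0 -mulrBr mulf_neq0 ?mulf_neq0 // subr_eq0.
    (* The two integers differ by n + m (k - n), which is positive because n > 0 and n <= k. *)
    apply/eqP => /(natr_inj0 charK0); rewrite /w.
    have -> : (n.-1 = n - 1)%N by lia.
    have [k1 ->] : exists k1, k = (n + k1)%N by exists (k - n)%N; rewrite subnKC.
    have [n1 ->] : exists n1, n = n1.+1 by exists n.-1; rewrite prednK.
    rewrite subn1 /=; have -> : (n1.+1 + k1 + n1.+1 - 2 = n1 + k1 + n1)%N by lia.
    by nia.
  by rewrite scaleNr E opprK.
have [c c0 lC] := wL C.+1.
have : lead 1 1 (w C.+1) (iter C.+1 (ad z) p) = 0.
  apply: (lead_small (ltn0Sn 0) (ltn0Sn 0) (pC C.+1)).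
  by rewrite /w; nia.
by rewrite lC => /eqP; rewrite scaler_eq0 (negPf c0) expf_eq0 polyX_eq0 andbF.
Qed.

(* For the weights (1, k + 1), ad z strictly lowers positive weights. *)
Lemma box_k0_eigen k z (l : K) w : box k 0 z -> w != 0 -> ad z w = l *: w -> l = 0.
Proof.
move=> zb w0 zw; apply/eqP; apply: contraT => l0.
have k10 : (0 < k.+1)%N by [].
have [d wd lw] := lead_exists hA (ltn0Sn 0) k10 w0.
have := @box_wt _ _ _ _ hA 1 k.+1 _ _ _ zb; rewrite mul1n muln0 addn0 => zk.
have := wt_le_comm (ltn0Sn 0) k10 zk wd; rewrite zw => zwd.
have wd' : wle 1 k.+1 (k + d - (1 + k.+1)) w.
  have -> : w = l^-1 *: (l *: w) by rewrite scalerA mulVf // scale1r.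
  exact: wt_leZ.
(* For d = 0 the truncated bound carries no information, but then w is a scalar and commutes with
   z. *)
have [d0|d0] := posnP d; last first.
  by move: lw; rewrite (lead_small (ltn0Sn 0) k10 wd') ?eqxx //; lia.
rewrite d0 in wd; have := wt0_central z (ltn0Sn 0) k10 wd.
rewrite -[ad w z]opprK -[- ad w z]/(- (w * z - z * w)) opprB -[z * w - w * z]/(ad z w) zw.
by move=> /eqP; rewrite oppr_eq0 scaler_eq0 (negPf l0) (negPf w0).
Qed.
End DixmierClasses.

(** * Comparison of boxes within an orbit and the diagonal boxes *)

Section Rigidity.
Variables (K : closedFieldType) (A : algType K) (p q : A).
Hypothesis hA : weyl_algebra p q.
Hypothesis charK0 : [pchar K] =i pred0.
Implicit Types z : A.

Lemma aut_box_rigid (f g : {lrmorphism A -> A}) k n k' n' z :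
  bijective f -> bijective g -> (k, n) <> (0, 0)%N -> (n <= k)%N -> (n' <= k')%N ->
  weyl_box p q k n (f z) -> weyl_box p q k' n' (g z) ->
  (k', n') = (k, n) /\ ((n < k)%N ->
    exists2 psi : {lrmorphism A -> A}, G0' p q psi & g z = psi (f z)).
Proof.
move=> fbij gbij kn nk nk' fb gb; have [h [hbij fK _]] := weyl_inv hA fbij.
have k0 : (0 < k)%N by case: k kn nk {fb} => [|//]; case: n.
have := @box_rigid _ _ _ _ hA (g \o h : {lrmorphism A -> A}) k n k' n' (f z).
rewrite /= fK; apply=> //; exact: bij_comp.
Qed.

Lemma box11_diag z (f : {lrmorphism A -> A}) : bijective f -> weyl_box p q 1 1 (f z) ->
  ad_diag z = setT /\ forall w, ad z (ad z w) = 0 -> ad z w = 0.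
Proof.
move=> fbij /(box11_form hA)[tau [a [b [taubij tauE]]]].
have [h [hbij fK hK]] := weyl_inv hA fbij; have [t [tbij tauK tK]] := weyl_inv hA taubij.
pose g : {lrmorphism A -> A} := h \o tau; pose g' : {lrmorphism A -> A} := t \o f.
have gK : cancel g' g by move=> x; rewrite /g /g' /= tK fK.
have zE : g (a *: (p * q) + b%:A) = z by rewrite /g /= tauE fK.
have ginj : injective g by apply/bij_inj/bij_comp.
split=> [|w].
  apply/seteqP; split=> // x _; rewrite -zE -(gK x).
  exact: ad_diag_morph (ad_pq_diag hA a b (g' x)).
rewrite -zE -(gK w) !ad_morph => E0.
rewrite (ad_pq_nil (w := g' w) hA) ?rmorph0 //.
by apply: ginj; rewrite E0 rmorph0.
Qed.

(** On the diagonal the leading form is a multiple of X^k of weight 2k, exactly the value excluded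
    by [rich_edge_form]; k > 1 makes this weight exceed 1 + 1. *)
Lemma box_neq k n z : ad_rich z -> (1 < k)%N -> weyl_box p q k n z -> n <> k.
Proof.
move=> rich k1 zb nk; rewrite nk in zb.
have zv : wt_le hA 1 1 (k + k) z.
  by have := @box_wt _ _ _ _ hA 1 1 _ _ _ zb; rewrite !mul1n.
have zl : wt_lead hA 1 1 (k + k) z = pqcoef hA z k k *: 'X^k.
  by have := box_lead hA (ltn0Sn 0) (ltn0Sn 0) zb; rewrite !mul1n.
have z0 : pqcoef hA z k k != 0 by have [] := (weyl_boxP hA _ _ _).1 zb.
have l0 : wt_lead hA 1 1 (k + k) z != 0.
  by rewrite zl scaler_eq0 (negPf z0) expf_eq0 polyX_eq0 andbF.
have sz : (size (wt_lead hA 1 1 (k + k) z)).-1 = k.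
  by rewrite zl size_scale // size_polyXn.
have [||+ _] := rich_edge_form charK0 (ltn0Sn 0) (ltn0Sn 0) zv l0 _ rich.
- by lia.
- by rewrite sz; lia.
by rewrite sz; lia.
Qed.
End Rigidity.

Theorem proposition1p1 (K : closedFieldType) (charK0 : [pchar K] =i pred0)
    (A : algType K) (p q : A) (hA : weyl_algebra p q)
    (z : A) (hz : is_nilpotent z \/ is_semisimple z) :
  (exists! kn : nat * nat, box_type p q z kn) /\
  (forall k n : nat, box_type p q z (k, n) ->
     (strictly_semisimple z -> (k, n) = (1, 1)%N) /\
     (is_nilpotent z \/ weak_semisimple z ->
        (n < k)%N /\
        forall z1 z2 : A,
          aut_equiv z z1 -> aut_equiv z z2 ->
          weyl_box p q k n z1 -> weyl_box p q k n z2 ->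
          exists2 phi : {lrmorphism A -> A}, G0' p q phi & z2 = phi z1)).
Proof.
have rich := classes_rich hA charK0 hz.
split.
  have [k [n [kn nk [f fbij fb]]]] := exists_box hA charK0 rich.
  exists (k, n); split; first by split=> //; exists f.
  move=> [k' n'] [/= _ nk' [g gbij gb]].
  by have [-> _] := aut_box_rigid hA fbij gbij kn nk nk' fb gb.
move=> k n [/= kn nk [f fbij fb]].
have k0 : (0 < k)%N by case: k kn nk {fb} => [|//]; case: n.
split=> [ss|nw].
  have [l [w [l0 w0 zw]]] := semisimple_witness hA charK0 (or_introl ss).
  have [g [gbij fK gK]] := weyl_inv hA fbij.
  have n0 : (0 < n)%N.
    rewrite lt0n; apply: contraNneq l0 => n0; rewrite n0 in fb.
    apply/eqP; apply: (box_k0_eigen hA fb (w := f w)).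
      by apply: contra_neq w0; rewrite -{1}(rmorph0 f) => /(bij_inj fbij).
    by rewrite ad_morph zw linearZ.
  have [kn2|kn2] := ltnP 2 (k + n).
    have fp : ad_diag (f z) p.
      have : ad_diag z (g p) by have [_ ->] := ss.
      by move=> /(ad_diag_morph (bij_inj fbij)); rewrite gK.
    by case: (box_growth charK0 n0 nk kn2 fb (ad_diag_bounded hA 1 1 fp)).
  by congr (_, _); lia.
have nltk : (n < k)%N.
  rewrite ltn_neqAle nk andbT; apply/eqP => nkE.
  have [k1|k1] := ltnP 1 k.
    by apply: (box_neq hA charK0 _ k1 fb nkE); apply: ad_rich_morph rich; apply: bij_inj.
  (* In the remaining box (1, 1), D(z) = A excludes weak semisimplicity, and the equality of the
     kernels of ad z and its square excludes nilpotency. *)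
  have k1E : k = 1%N by lia.
  rewrite nkE k1E in fb; have [Dz nilz] := box11_diag hA fbij fb.
  case: nw => [/(nilpotent_witness hA charK0)[w [zw /nilz]]//|[_ _]]; exact.
split=> // z1 z2 [f1 f1bij ->] [f2 f2bij ->] z1b z2b.
by have [_] := aut_box_rigid hA f1bij f2bij kn nk nk z1b z2b; apply.
Qed.
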